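(* Let $H_0$ be a self-adjoint operator in a complex Hilbert space $\mathcal{H}$ with spectral gap $(-\delta,\delta)$, $\delta>0$ (that is, $(-\delta,\delta)\subset\rho(H_0)$), and let $P_+$ and $P_-$ be the spectral projections of $H_0$ corresponding to its positive and negative spectrum, respectively. Let $\mathfrak{v}$ be a symmetric sesquilinear form such that its domain $\mathcal{D}(\mathfrak{v})$ is a core for $|H_0|^{1/2}$ and such that $$\sup_{\substack{x,y\in\mathcal{H}\\ \|x\|=\|y\|=1}}\left|\mathfrak{v}\left[|H_0|^{-1/2}x,|H_0|^{-1/2}y\right]\right|<\infty,$$ $$\rho:=\sup_{\substack{x,y\in P_+\mathcal{H}\cup P_-\mathcal{H}\\ \|x\|=\|y\|=1}}\left|\mathfrak{v}\left[|H_0|^{-1/2}x,|H_0|^{-1/2}y\right]\right|<1 .$$ Let $\widetilde{P}_{\pm}$ be a pair of complementary projections in $\mathcal{H}$ such that $$\nu:=\|P_{\pm}-\widetilde{P}_{\pm}\|<1,\qquad \arctan\sqrt{\frac{\rho}{2-\rho}}+\arcsin\nu<\frac{\pi}{2}.$$ Then: (i) There exists a unique self-adjoint operator $H$ associated to the form $\mathfrak{h}:=\mathfrak{h}_0+\mathfrak{v}$; moreover, $0\in\rho(H)$, and $\mathcal{D}(H)$ is a core for $|H_0|^{1/2}$. (ii) Let $Q_{\pm}$ denote the spectral projections of $H$ corresponding to the positive and negative spectrum, respectively. Then $\widetilde{P}_{\pm}|_{Q_{\pm}\mathcal{H}}:Q_{\pm}\mathcal{H}\to\widetilde{P}_{\pm}\mathcal{H}$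 are isomorphisms (linear homeomorphisms), and, with $X_{\pm}:=\widetilde{P}_{\mp}(\widetilde{P}_{\pm}|_{Q_{\pm}\mathcal{H}})^{-1}$, $$Q_+\mathcal{H}=\{x+X_+x:x\in\widetilde{P}_+\mathcal{H}\},\qquad Q_-\mathcal{H}=\{y+X_-y:y\in\widetilde{P}_-\mathcal{H}\},$$ $$\|X_{\pm}\|\le\tan\left(\arctan\sqrt{\frac{\rho}{2-\rho}}+\arcsin\nu\right),\qquad X_-=-X_+^*.$$
   Context: Inner products are linear in the first variable. A pair of complementary projections in $\mathcal{H}$ is a pair of bounded idempotents $\widetilde P_\pm$ with $\widetilde P_++\widetilde P_-=I$. Set $\mathcal{Q}:=\mathcal{D}(|H_0|^{1/2})$ and $\mathfrak{h}_0[u,v]:=(|H_0|^{1/2}u,\operatorname{sign}(H_0)|H_0|^{1/2}v)$ for $u,v\in\mathcal{Q}$. A form $\mathfrak{v}$ defined on a core of $|H_0|^{1/2}$ and bounded there by a constant times $\||H_0|^{1/2}u\|\,\||H_0|^{1/2}v\|$ extends uniquely by continuity to $\mathcal{Q}$; it is always identified with this extension, so $\mathcal{D}(\mathfrak{v})=\mathcal{Q}$, and the suprema are understood for the extended form. An operator $H$ is associated with a densely defined sesquilinear form $\mathfrak{h}$ if: $H$ is closed and densely defined; $\mathcal{D}(H),\mathcal{D}(H^* )\subset\mathcal{D}(\mathfrak{h})$; $(Hu,v)=\mathfrak{h}[u,v]$ for $u\in\mathcal{D}(H)$, $v\in\mathcal{D}(\mathfrak{h})$; and $(u,H^*v)=\mathfrak{h}[u,v]$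 for $u\in\mathcal{D}(\mathfrak{h})$, $v\in\mathcal{D}(H^* )$.
   Formalization: The last identity X_- = -X_+^* is stated only when the ranges of the complementary projections are orthogonal; for oblique projections it fails, e.g. H_0=diag(1,-1), v=0, P̃_+=[[1,t],[0,0]], 0<t<1, where X_+=0 but X_-≠0. *)

(* Defs.v *)
From HB Require Import structures.
From mathcomp Require Import all_boot all_order all_algebra.
From mathcomp Require Import sesquilinear complex.
From mathcomp Require Import all_classical all_reals all_analysis.

Set Implicit Arguments.
Unset Strict Implicit.
Unset Printing Implicit Defensive.

Import Order.TTheory GRing.Theory Num.Theory.
Import numFieldNormedType.Exports.

Local Open Scope classical_set_scope.
Local Open Scope complex_scope.
Local Open Scope ring_scope.

(* The inner product [ip] is linear in its first argument and conjugate-linear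
   in the second.  An unbounded operator is identified with its graph, a set of
   pairs (argument, value), so that equality of operators is equality of
   graphs, and in particular includes equality of domains. *)
Section Operators.
Context {R : realType} {V : completeNormedModType R[i]}.
Variable ip : {dot V for @Num.conj R[i]}.
Implicit Types (G H : set (V * V)) (D K L W : set V) (f : V -> V -> R[i]).

Definition subspace_set D : Prop :=
  D 0 /\ forall (a : R[i]) u w, D u -> D w -> D (a *: u + w).

Definition op_dom G : set V := [set x | exists y, G (x, y)].

Definition op_app G (x : V) : V := xget 0 [set y | G (x, y)].

Definition op_inv G : set (V * V) := [set p | G (p.2, p.1)].

Definition is_operator G : Prop :=
  [/\ G (0, 0),
      forall (a : R[i]) x y x' y',
        G (x, y) -> G (x', y') -> G (a *: x + x', a *: y + y')
    & forall x y y', G (x, y) -> G (x, y') -> y = y'].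

Definition densely_defined G : Prop := closure (op_dom G) = setT.

Definition op_adjoint G : set (V * V) :=
  [set p | forall u w, G (u, w) -> ip w p.1 = ip u p.2].

Definition self_adjoint G : Prop :=
  [/\ is_operator G, densely_defined G & op_adjoint G = G].

Definition resolvent_set G : set R[i] :=
  [set z | exists T : {linear V -> V}, continuous T /\
     forall x y, (exists2 w, G (x, w) & y = w - z *: x) <-> x = T y].

(* D is a core: the closure of the restriction of G to D is G. *)
Definition op_core D G : Prop :=
  [/\ subspace_set D, D `<=` op_dom G & closure (G `&` [set p | D p.1]) = G].

Definition sesquilinear_on D f : Prop :=
  [/\ subspace_set D,
      forall (a : R[i]) u u' w, D u -> D u' -> D w ->
        f (a *: u + u') w = a * f u w + f u' w
    & forall (a : R[i]) u w w', D u -> D w -> D w' ->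
        f u (a *: w + w') = Num.conj a * f u w + f u w'].

Definition symmetric_on D f : Prop :=
  forall u w, D u -> D w -> f u w = Num.conj (f w u).

Definition form_bounded (A : set (V * V)) D f : Prop :=
  exists C : R, forall u w, D u -> D w ->
    `|f u w| <= C%:C * `|op_app A u| * `|op_app A w|.

(* f is the extension by continuity to the domain of A of the form f0 given
   on D; such an extension is unique when D is a core for A. *)
Definition form_extension (A : set (V * V)) D f0 f : Prop :=
  [/\ forall u w, D u -> D w -> f u w = f0 u w,
      sesquilinear_on (op_dom A) f
    & form_bounded A (op_dom A) f].

Definition associated H D f : Prop :=
  [/\ is_operator H, closed H, densely_defined H,
      op_dom H `<=` D /\ op_dom (op_adjoint H) `<=` D
    & (forall u y w, H (u, y) -> D w -> ip y w = f u w) /\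
      (forall u w y, D u -> op_adjoint H (w, y) -> ip u y = f u w)].

(* Projection-valued (spectral) measures on the Borel sets of the real line;
   countable additivity is the requirement that every
   B |-> (E(B) x, x) be a measure. *)
Record pvm := Pvm {
  pvm_proj :> set R -> {linear V -> V};
  pvm_meas : V -> {measure set (measurableTypeR R) -> \bar R};
  pvm_projT : forall x, pvm_proj setT x = x;
  pvm_projI : forall A B : set (measurableTypeR R),
    measurable A -> measurable B ->
    forall x, pvm_proj A (pvm_proj B x) = pvm_proj (A `&` B) x;
  pvm_proj_sym : forall B : set (measurableTypeR R), measurable B ->
    forall x y, ip (pvm_proj B x) y = ip x (pvm_proj B y);
  pvm_measE : forall x (B : set (measurableTypeR R)), measurable B ->
    pvm_meas x B = (complex.Re (ip (pvm_proj B x) x))%:E }.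

Implicit Types (E : pvm) (g : measurableTypeR R -> R).

(* The integral of g with respect to the complex measure B |-> (E(B) x, y),
   obtained by polarization from the measures B |-> (E(B) x, x). *)
Definition pvm_form E g (x y : V) : R[i] :=
  4^-1 * \sum_(k < 4) 'i ^+ k *
    (Rintegral (pvm_meas E (x + 'i ^+ k *: y)) setT g)%:C.

Definition pvm_fun_dom E g : set V :=
  [set x | (pvm_meas E x).-integrable setT (fun t => ((g t) ^+ 2)%:E)].

(* The operator \int g dE of the functional calculus, for g real-valued. *)
Definition pvm_fun E g : set (V * V) :=
  [set p | pvm_fun_dom E g p.1 /\
     forall z, pvm_fun_dom E g z -> ip p.2 z = pvm_form E g p.1 z].

Definition spectral_measure_of E H : Prop := pvm_fun E idfun = H.

(* With E the spectral measure of H: |H|^{1/2} and sign(H). *)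
Definition sqrt_abs E : set (V * V) := pvm_fun E (fun t => Num.sqrt `|t|).
Definition sign_op E : set (V * V) := pvm_fun E (fun t => Num.sg t).

Definition pos_proj E : {linear V -> V} := E `]0, +oo[%classic.
Definition neg_proj E : {linear V -> V} := E `]-oo, 0[%classic.

Definition h0_form E (u w : V) : R[i] :=
  ip (op_app (sqrt_abs E) u)
     (op_app (sign_op E) (op_app (sqrt_abs E) w)).

(* The values |f[|H|^{-1/2} x, |H|^{-1/2} y]| for unit vectors x, y of W. *)
Definition form_values E f W : set R :=
  [set r | exists x y, [/\ W x, W y, `|x| = 1, `|y| = 1
     & r = complex.Re `|f (op_app (op_inv (sqrt_abs E)) x)
                          (op_app (op_inv (sqrt_abs E)) y)|]].

(* Norm of the restriction of T to W, +oo if that restriction is unbounded. *)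
Definition opnorm_on W (T : V -> V) : \bar R :=
  ereal_sup [set (complex.Re `|T x|)%:E | x in [set x | W x /\ `|x| <= 1]].

Definition complementary_projections (P P' : {linear V -> V}) : Prop :=
  [/\ continuous P, continuous P',
      forall x, P (P x) = P x, forall x, P' (P' x) = P' x
    & forall x, P x + P' x = x].

Definition linear_homeo K L (T : {linear V -> V}) : Prop :=
  [/\ set_bij K L T, {within K, continuous T}
    & {within L, continuous ('pinv_(fun=> 0) K T)}].

(* P' (P|_K)^{-1} *)
Definition angular_op (P P' : V -> V) K : V -> V :=
  fun x => P' ('pinv_(fun=> 0) K P x).

(* Y : L -> K is the adjoint of X : K -> L.  For complementary projections
   P, P' that are not orthogonal, X = angular_op P P' Q_+ and
   Y = - angular_op P' P Q_- need not be adjoint, even when Q_+ and Q_- are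
   orthogonal complements: in C^2, with Q_+ and P both onto the line of e1,
   Q_- onto that of e2 and P' onto that of (-sin b, cos b), one gets
   X = 0 and Y <> 0 unless sin b = 0. *)
Definition adjoint_on K L (X Y : V -> V) : Prop :=
  [/\ forall x, K x -> L (X x), forall y, L y -> K (Y y)
    & forall x y, K x -> L y -> ip (X x) y = ip x (Y y)].

End Operators.

(* Main.v *)
(* Put B = |H_0|^{-1/2}, J = sign(H_0), and let M be the bounded operator of the
   form v[B x, B y].  Then h[B x, B y] = ((J + M) x, y), and W = J + M is
   boundedly invertible because Re (W x, J x) >= (1 - rho) |x|^2; the operator
   associated with h is the inverse of the bounded symmetric operator B W^-1 B.
   With k = 1 - rho, the bounds on the blocks of M give Re (W x, (J -+ k) x) >= 0,
   which is the Lyapunov inequality Re (H u, (J -+ k) u) >= 0.  On Q_+ (where H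
   is positive) the Cayley transform of H turns it into ((J - k) x, x) >= 0, that
   is |P_- x| <= tan t |P_+ x| with tan^2 t = rho / (2 - rho), and symmetrically
   on Q_-.  Writing x in Q_+ as a + b along the ranges of the two perturbed
   projections, |P_- a| <= nu |a| and |P_+ b| <= nu |b|, and addition of angles
   gives |b| <= tan (t + arcsin nu) |a|.  Surjectivity of the perturbed
   projection on Q_+ holds because a vector orthogonal to its image and to the
   range of the other projection lies in Q_-, where |P_- y| <= nu |y| contradicts
   nu < cos t.

   The functional calculus is needed only to the extent that
   \int g dE \int f dE = \int g f dE when f and g f are bounded; this gives
   the bounded inverse of |H_0|^{1/2} and, applied to f = 1_A / (1 +- t), the
   Cayley transform. *)
Require Import Defs.
From HB Require Import structures.
From mathcomp Require Import all_boot all_order all_algebra.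
From mathcomp Require Import sesquilinear complex.
From mathcomp Require Import all_classical all_reals all_analysis.
From mathcomp Require Import measurable_realfun ring lra.

Set Implicit Arguments.
Unset Strict Implicit.
Unset Printing Implicit Defensive.

Import Order.TTheory GRing.Theory Num.Theory.
Import numFieldNormedType.Exports.

Local Open Scope classical_set_scope.
Local Open Scope complex_scope.
Local Open Scope ring_scope.

(** * Real inner product, projections and the Riesz representation *)

Section Inner.
Context {R : realType} {V : completeNormedModType R[i]}.
Variable ip : {dot V for @Num.conj R[i]}.
Hypothesis hip : forall x : V, `|x| ^+ 2 = ip x x.
Implicit Types (x y z : V) (a : R[i]).

(** The constant k = 1 - rho is cos 2t for tan^2 t = rho / (2 - rho): the cone |P_- x| <= tan t |P_+
    x| is exactly where ((J - k) x, x) >= 0, so a bound on an angle becomes positivity of a bounded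
    quadratic form. The spectral projections of H are known only through a measure that integrates t
    to H; nothing ties them to P_+ and P_- directly, and the Lyapunov inequality is the one link.
    Iterating the Cayley transform plays the part of the semigroup exp(-tH) on Q_+: on spectral
    bands away from 0 and infinity it contracts uniformly and involves bounded functions only. Since
    integrals are defined by polarization, even their sesquilinearity is not visible. Such
    identities are read as equalities of functionals of the integrand and checked on indicators,
    where they concern projections alone. Every statement about Q_+ has a twin for Q_-: a sign s = 1
    or s = -1, or an exchange of the two members of each pair of projections, covers both. *)

Definition rnorm {W : normedZmodType R[i]} (x : W) : R := complex.Re `|x|.
Definition rip (x y : V) : R := complex.Re (ip x y).

Lemma rnormE {W : normedZmodType R[i]} (x : W) : `|x| = (rnorm x)%:C.
Proof. by rewrite /rnorm RRe_real// ger0_real. Qed.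

Lemma rnorm_ge0 {W : normedZmodType R[i]} (x : W) : 0 <= rnorm x.
Proof. by rewrite -ler0c -rnormE. Qed.

Lemma rnormD {W : normedZmodType R[i]} (x y : W) :
  rnorm (x + y) <= rnorm x + rnorm y.
Proof. by rewrite -lecR rmorphD/= -!rnormE ler_normD. Qed.

Lemma rnormN {W : normedZmodType R[i]} (x : W) : rnorm (- x) = rnorm x.
Proof. by rewrite /rnorm normrN. Qed.

Lemma rnormBC {W : normedZmodType R[i]} (x y : W) : rnorm (x - y) = rnorm (y - x).
Proof. by rewrite /rnorm distrC. Qed.

Lemma rnorm0 {W : normedZmodType R[i]} : rnorm (0 : W) = 0.
Proof. by rewrite /rnorm normr0. Qed.

Lemma rnorm0_eq0 {W : normedZmodType R[i]} (x : W) : rnorm x = 0 -> x = 0.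
Proof. by move=> h; apply/normr0_eq0; rewrite rnormE h. Qed.

Lemma rnormZ a x : rnorm (a *: x) = rnorm a * rnorm x.
Proof. by rewrite {1}/rnorm normrZ !rnormE -rmorphM. Qed.

Lemma rnormC (t : R) : rnorm t%:C = `|t|.
Proof. by rewrite /rnorm normc_def/= expr0n/= addr0 sqrtr_sqr. Qed.

Lemma rnormM (a b : R[i]) : rnorm (a * b) = rnorm a * rnorm b.
Proof. by rewrite {1}/rnorm normrM !rnormE -rmorphM. Qed.

Lemma rnorm_conj (a : R[i]) : rnorm (Num.conj a) = rnorm a.
Proof. by rewrite /rnorm norm_conjC. Qed.

Lemma normRe_le (a : R[i]) : `|complex.Re a| <= rnorm a.
Proof. by rewrite -lecR -rnormE normc_ge_Re. Qed.

Lemma ipDl x y z : ip (x + y) z = ip x z + ip y z.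
Proof. exact: linearDl. Qed.
Lemma ipDr x y z : ip z (x + y) = ip z x + ip z y.
Proof. exact: linearDr. Qed.
Lemma ipNl x z : ip (- x) z = - ip x z.
Proof. exact: linearNl. Qed.
Lemma ipNr x z : ip z (- x) = - ip z x.
Proof. exact: linearNr. Qed.
Lemma ipBl x y z : ip (x - y) z = ip x z - ip y z.
Proof. exact: linearBl. Qed.
Lemma ipBr x y z : ip z (x - y) = ip z x - ip z y.
Proof. exact: linearBr. Qed.
Lemma ipZl a x z : ip (a *: x) z = a * ip x z.
Proof. exact: linearZl_LR. Qed.
Lemma ipZr a x z : ip z (a *: x) = Num.conj a * ip z x.
Proof. exact: linearZr_LR. Qed.
Lemma ip0l z : ip 0 z = 0.
Proof. exact: linear0l. Qed.
Lemma ip0r z : ip z 0 = 0.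
Proof. exact: linear0r. Qed.
Lemma ipC x y : ip x y = Num.conj (ip y x).
Proof. by rewrite {1}[ip x y]hermC expr0 mul1r. Qed.

Lemma Re_cj a : complex.Re (Num.conj a) = complex.Re a.
Proof. by case: a. Qed.
Lemma ReD a b : complex.Re (a + b) = complex.Re a + complex.Re b.
Proof. by case: a b => [? ?] []. Qed.
Lemma ReN a : complex.Re (- a) = - complex.Re a.
Proof. by case: a. Qed.
Lemma ReB a b : complex.Re (a - b) = complex.Re a - complex.Re b.
Proof. by rewrite ReD ReN. Qed.
Lemma ReCM (t : R) a : complex.Re (t%:C * a) = t * complex.Re a.
Proof. by case: a => u w /=; rewrite mul0r subr0. Qed.
Lemma conjC_real (t : R) : Num.conj t%:C = t%:C.
Proof. exact: conjc_real. Qed.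

Lemma cjM a b : Num.conj (a * b) = Num.conj a * Num.conj b.
Proof. exact: rmorphM. Qed.
Lemma cjD a b : Num.conj (a + b) = Num.conj a + Num.conj b.
Proof. exact: rmorphD. Qed.
Lemma cjN a : Num.conj (- a) = - Num.conj a.
Proof. exact: rmorphN. Qed.
Lemma cjK a : Num.conj (Num.conj a) = a.
Proof. exact: conjCK. Qed.

Lemma ripC x y : rip x y = rip y x.
Proof. by rewrite /rip ipC Re_cj. Qed.
Lemma ripDl x y z : rip (x + y) z = rip x z + rip y z.
Proof. by rewrite /rip ipDl ReD. Qed.
Lemma ripDr x y z : rip z (x + y) = rip z x + rip z y.
Proof. by rewrite /rip ipDr ReD. Qed.
Lemma ripNl x z : rip (- x) z = - rip x z.
Proof. by rewrite /rip ipNl ReN. Qed.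
Lemma ripNr x z : rip z (- x) = - rip z x.
Proof. by rewrite /rip ipNr ReN. Qed.
Lemma ripBl x y z : rip (x - y) z = rip x z - rip y z.
Proof. by rewrite /rip ipBl ReB. Qed.
Lemma ripBr x y z : rip z (x - y) = rip z x - rip z y.
Proof. by rewrite /rip ipBr ReB. Qed.
Lemma ripZl (t : R) x z : rip (t%:C *: x) z = t * rip x z.
Proof. by rewrite /rip ipZl ReCM. Qed.
Lemma ripZr (t : R) x z : rip z (t%:C *: x) = t * rip z x.
Proof. by rewrite ripC ripZl ripC. Qed.
Lemma rip0l z : rip 0 z = 0.
Proof. by rewrite /rip ip0l. Qed.
Lemma rip0r z : rip z 0 = 0.
Proof. by rewrite /rip ip0r. Qed.

Lemma ipxx x : ip x x = (rnorm x ^+ 2)%:C.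
Proof. by rewrite -hip rnormE rmorphXn. Qed.
Lemma ripxx x : rip x x = rnorm x ^+ 2.
Proof. by rewrite /rip ipxx. Qed.

Lemma rnormD2 x y : rnorm (x + y) ^+ 2 = rnorm x ^+ 2 + rnorm y ^+ 2 + 2 * rip x y.
Proof. by rewrite -!ripxx ripDl !ripDr (ripC y x); ring. Qed.
Lemma rnormB2 x y : rnorm (x - y) ^+ 2 = rnorm x ^+ 2 + rnorm y ^+ 2 - 2 * rip x y.
Proof. by rewrite -!ripxx ripBl !ripBr (ripC y x); ring. Qed.

(** Zero vectors aside, this is the expansion of the squared norm of |y| x - |x| y. *)
Lemma rip_le x y : rip x y <= rnorm x * rnorm y.
Proof.
have [x0|x0] := eqVneq (rnorm x) 0.
  by rewrite (rnorm0_eq0 x0) rip0l rnorm0 mul0r.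
have [y0|y0] := eqVneq (rnorm y) 0.
  by rewrite (rnorm0_eq0 y0) rip0r rnorm0 mulr0.
have xy : 0 < rnorm x * rnorm y by rewrite mulr_gt0// lt_def rnorm_ge0 andbT.
have := rnormB2 ((rnorm y)%:C *: x) ((rnorm x)%:C *: y).
rewrite ripZl ripZr !rnormZ !rnormC !ger0_norm ?rnorm_ge0// => e.
have : 0 <= 2 * (rnorm x * rnorm y) * (rnorm x * rnorm y - rip x y).
  have := sqr_ge0 (rnorm ((rnorm y)%:C *: x - (rnorm x)%:C *: y)).
  by rewrite e; lra.
have p : 0 < 2 * (rnorm x * rnorm y) by rewrite mulr_gt0.
by rewrite (pmulr_rge0 _ p) subr_ge0.
Qed.

(** Multiplying [y] by [ip x y] absorbs the phase, so the real inequality gives the complex one. *)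
Lemma ip_le x y : rnorm (ip x y) <= rnorm x * rnorm y.
Proof.
have [->|n0] := eqVneq (ip x y) 0.
  by rewrite rnorm0 mulr_ge0 ?rnorm_ge0.
have n0' : 0 < rnorm (ip x y).
  by rewrite lt_def rnorm_ge0 andbT; apply: contra_neq n0 => /rnorm0_eq0.
have := rip_le x (ip x y *: y).
rewrite {1}/rip ipZr mulrC -sqr_normc rnormE -rmorphXn/= rnormZ mulrCA expr2.
by rewrite ler_pM2l.
Qed.

Lemma ip_ext x y : (forall z, ip x z = ip y z) -> x = y.
Proof.
move=> h; apply/eqP; rewrite -subr_eq0; apply/eqP/rnorm0_eq0/eqP.
by rewrite -sqrf_eq0 -ripxx /rip ipBl h subrr.
Qed.

Lemma rip_ip0 x y : (forall a, rip x (a *: y) = 0) -> ip x y = 0.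
Proof.
move=> h; have := h (ip x y).
rewrite /rip ipZr mulrC -sqr_normc rnormE -rmorphXn/= => /eqP.
by rewrite sqrf_eq0 => /eqP/rnorm0_eq0.
Qed.

Lemma ltr0c (e : R) : (0 < e%:C :> R[i]) = (0 < e).
Proof. by rewrite ltcE/= eqxx. Qed.

Lemma closure_rnormP {W : normedModType R[i]} (A : set W) (x : W) :
  closure A x <-> forall e : R, 0 < e -> exists2 a, A a & rnorm (x - a) < e.
Proof.
split=> [cA e e0|h B].
  have [|a [Aa]] := cA (ball x e%:C); first by apply: nbhsx_ballx; rewrite ltr0c.
  by rewrite -ball_normE/= rnormE ltcR => ?; exists a.
move=> /nbhs_ballP[e /= e0 eB].
have [|a Aa xa] := h (complex.Re e).
  by move: e0; rewrite ltcE => /andP[].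
exists a; split => //; apply: eB; rewrite -ball_normE/= rnormE ltcE/=.
by rewrite xa andbT; move: e0; rewrite ltcE => /andP[].
Qed.

Lemma rnorm_complete (u : nat -> V) :
  (forall e : R, 0 < e -> exists N, forall n m, (N <= n)%N -> (N <= m)%N ->
     rnorm (u n - u m) < e) ->
  exists l, forall e : R, 0 < e ->
    exists N, forall n, (N <= n)%N -> rnorm (l - u n) < e.
Proof.
move=> h.
have /cauchy_cvgP/cvg_ex[l ul] : cauchy (u @ \oo).
  apply/cauchy_ballP => e e0; rewrite near_map2.
  have [|N hN] := h (complex.Re e); first by move: e0; rewrite ltcE => /andP[].
  exists ([set n | (N <= n)%N], [set n | (N <= n)%N]) => /=.
    by split; exists N.
  case=> n m /= [Nn Nm]; rewrite -ball_normE/= rnormE ltcE/= hN// andbT.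
  by move: e0; rewrite ltcE => /andP[].
exists l => e e0.
have : \forall n \near \oo, ball l e%:C (u n).
  by apply: ul; apply: nbhsx_ballx; rewrite ltr0c.
case=> N _ hN; exists N => n Nn; have := hN n Nn.
by rewrite -ball_normE/= rnormE ltcR.
Qed.

(** * Closed subspaces, orthogonal projection and the Riesz representation *)

Lemma subspaceD (K : set V) x y : subspace_set K -> K x -> K y -> K (x + y).
Proof. by move=> [_ h] Kx Ky; have := h 1 _ _ Kx Ky; rewrite scale1r. Qed.
Lemma subspaceZ (K : set V) a x : subspace_set K -> K x -> K (a *: x).
Proof. by move=> [K0 h] Kx; have := h a _ _ Kx K0; rewrite addr0. Qed.
Lemma subspaceB (K : set V) x y : subspace_set K -> K x -> K y -> K (x - y).
Proof.
by move=> sK Kx Ky; apply: subspaceD => //; rewrite -scaleN1r; exact: subspaceZ.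
Qed.

Lemma small_inv (e : R) : 0 < e -> exists N, forall n, (N <= n)%N -> n.+1%:R^-1 < e.
Proof.
move=> e0; exists (Num.truncn e^-1) => n Nn.
rewrite invf_plt ?posrE//; apply: lt_le_trans (truncnS_gt _) _.
by rewrite ler_nat.
Qed.

(** A minimizing sequence for the distance is Cauchy by the parallelogram law, because midpoints
    stay in [K]; the limit is the foot of the perpendicular by a first-variation argument. *)
Lemma orthogonal_projection (K : set V) x : subspace_set K -> closed K ->
  exists2 p, K p & forall k, K k -> ip (x - p) k = 0.
Proof.
move=> sK cK; pose D := [set rnorm (x - k) | k in K].
have hD : has_inf D.
  split; first by exists (rnorm (x - 0)), 0 => //; exact: sK.1.
  by exists 0 => _ [k _ <-]; exact: rnorm_ge0.
pose d := inf D.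
have dle k : K k -> d <= rnorm (x - k).
  by move=> Kk; apply: ge_inf; [exact: hD.2|exists k].
have d0 : 0 <= d.
  by apply: lb_le_inf; [exact: hD.1|move=> _ [k _ <-]; exact: rnorm_ge0].
have /choice[u hu] : forall n : nat, exists k, K k /\ rnorm (x - k) < d + n.+1%:R^-1.
  move=> n; have [|_ [k Kk <-] h] := @inf_adherent _ D n.+1%:R^-1 _ hD.
    by rewrite invr_gt0.
  by exists k.
have par k l : K k -> K l ->
    rnorm (k - l) ^+ 2 <= 2 * rnorm (x - k) ^+ 2 + 2 * rnorm (x - l) ^+ 2 - 4 * d ^+ 2.
  move=> Kk Kl.
  have : d ^+ 2 <= rnorm (x - (2^-1 : R)%:C *: (k + l)) ^+ 2.
    rewrite ler_pXn2r ?nnegrE ?rnorm_ge0//; apply: dle; apply: subspaceZ => //.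
    exact: subspaceD.
  rewrite !rnormB2 rnormZ rnormC ger0_norm ?invr_ge0// exprMn rnormD2.
  by rewrite ripZr ripDr; lra.
have [p hp] : exists l, forall e : R, 0 < e ->
    exists N, forall n, (N <= n)%N -> rnorm (l - u n) < e.
  apply: rnorm_complete => e e0.
  (* As 0 < c <= 1, the parallelogram estimate is at most 4 (d + c)^2 - 4 d^2 <= c (8 d + 4) <
     e^2. *)
  pose c := Num.min 1 (e ^+ 2 / (8 * d + 5)).
  have c0 : 0 < c by rewrite lt_min ltr01/= divr_gt0// ?exprn_gt0//; lra.
  have [N hN] := small_inv c0; exists N => n m Nn Nm.
  rewrite -(ltr_pXn2r (n := 2)) ?nnegrE ?rnorm_ge0//; last exact: ltW.
  apply: le_lt_trans (par _ _ (hu n).1 (hu m).1) _.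
  have c1 : c <= 1 by rewrite ge_min lexx.
  have c2 : c * (8 * d + 5) <= e ^+ 2.
    rewrite -ler_pdivlMr; first by rewrite ge_min lexx orbT.
    by lra.
  have aux k : (N <= k)%N -> rnorm (x - u k) ^+ 2 <= (d + c) ^+ 2.
    move=> Nk; rewrite ler_pXn2r ?nnegrE ?rnorm_ge0//; last by lra.
    by apply: ltW; apply: lt_trans (hu k).2 _; rewrite ltrD2l hN.
  have := aux _ Nn; have := aux _ Nm.
  have : c ^+ 2 <= c by rewrite expr2 ger_pMl.
  by nra.
have Kp : K p.
  apply: cK; apply/closure_rnormP => e e0; have [N hN] := hp e e0.
  by exists (u N); [exact: (hu N).1|exact: hN].
have pd : rnorm (x - p) <= d.
  suff h (e : R) : 0 < e -> rnorm (x - p) <= d + e by apply/ler_addgt0Pr.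
  move=> e0.
  have [|N hN] := hp (e / 2); first by rewrite divr_gt0.
  have [|N' hN'] := @small_inv (e / 2); first by rewrite divr_gt0.
  have := hN (maxn N N') (leq_maxl _ _); have := hN' (maxn N N') (leq_maxr _ _).
  have := (hu (maxn N N')).2; have := rnormD (x - u (maxn N N')) (u (maxn N N') - p).
  rewrite addrA subrK (rnormBC (u _) p).
  by move: (_.+1%:R^-1) => j; lra.
exists p => // k Kk; apply: rip_ip0 => a.
have : forall k, K k -> 0 <= rip (x - p) k.
  move=> {Kk}k Kk; rewrite leNgt; apply/negP => neg.
  pose t := rip (x - p) k / (rnorm k ^+ 2 + 1).
  have n0 : 0 < rnorm k ^+ 2 + 1 by rewrite ltr_wpDl// sqr_ge0.
  have : d ^+ 2 <= rnorm (x - p - t%:C *: k) ^+ 2.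
    rewrite ler_pXn2r ?nnegrE ?rnorm_ge0// -addrA -opprD; apply: dle.
    by apply: subspaceD => //; exact: subspaceZ.
  have : rnorm (x - p) ^+ 2 <= d ^+ 2 by rewrite ler_pXn2r ?nnegrE ?rnorm_ge0.
  rewrite (rnormB2 (x - p)) rnormZ rnormC exprMn (real_normK (num_real t)) ripZr.
  have te : t * (rnorm k ^+ 2 + 1) = rip (x - p) k by rewrite divfK ?gt_eqF.
  have t0 : t < 0 by rewrite pmulr_llt0 ?invr_gt0.
  move: (sqr_ge0 (rnorm k)) te; set r := rip _ k; set n := rnorm k ^+ 2.
  by nra.
move=> h; apply/eqP; rewrite eq_le h ?andbT; last exact: subspaceZ.
rewrite -oppr_ge0 -ripNr; apply: h; rewrite -scaleN1r; apply: subspaceZ => //.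
exact: subspaceZ.
Qed.

Lemma closure_full (K : set V) : subspace_set K ->
  (forall y, (forall k, K k -> ip y k = 0) -> y = 0) -> closure K = setT.
Proof.
move=> sK h; apply/seteqP; split=> // x _.
have sKc : subspace_set (closure K).
  split; first by apply: subset_closure; exact: sK.1.
  move=> a u w /closure_rnormP cu /closure_rnormP cw; apply/closure_rnormP => e e0.
  have a1 : 0 < rnorm a + 1 by rewrite ltr_wpDl// rnorm_ge0.
  have [|k Kk uk] := cu (e / 2 / (rnorm a + 1)); first by rewrite !divr_gt0.
  have [|l Kl wl] := cw (e / 2); first by rewrite divr_gt0.
  exists (a *: k + l); first exact: sK.2.
  rewrite opprD addrACA -scalerBr; apply: le_lt_trans (rnormD _ _) _.
  rewrite (splitr e) rnormZ ler_ltD//.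
  apply: le_trans (_ : (rnorm a + 1) * rnorm (u - k) <= _).
    by rewrite ler_wpM2r ?rnorm_ge0// lerDl.
  by rewrite mulrC -ler_pdivlMr// ltW.
have [p Kp xp] := orthogonal_projection x sKc (@closed_closure _ K).
suff /eqP : x - p = 0 by rewrite subr_eq0 => /eqP ->.
by apply: h => k Kk; apply: xp; exact: subset_closure.
Qed.

(** Take z nonzero and orthogonal to the kernel: every x is a multiple of z modulo the kernel, so
    the functional is a multiple of x |-> (x, z), with the factor fixed by its value at z. *)
Lemma riesz (phi : V -> R[i]) (C : R) :
  (forall a x y, phi (a *: x + y) = a * phi x + phi y) ->
  (forall x, rnorm (phi x) <= C * rnorm x) ->
  exists y, forall x, phi x = ip x y.
Proof.
move=> lin bnd.
have phi0 : phi 0 = 0.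
  by apply/rnorm0_eq0/eqP; rewrite eq_le rnorm_ge0 (le_trans (bnd 0))// rnorm0 mulr0.
have phiD x y : phi (x + y) = phi x + phi y by have := lin 1 x y; rewrite scale1r mul1r.
have phiZ a x : phi (a *: x) = a * phi x by have := lin a x 0; rewrite phi0 !addr0.
have phiN x : phi (- x) = - phi x by rewrite -scaleN1r phiZ mulN1r.
pose K : set V := [set x | phi x = 0].
have sK : subspace_set K.
  by split => // a u w; rewrite /K/= lin => -> ->; rewrite mulr0 addr0.
have cK : closed K.
  move=> x /closure_rnormP cx; apply/rnorm0_eq0/eqP; rewrite eq_le rnorm_ge0 andbT.
  apply/ler_addgt0Pr => e e0; rewrite add0r.
  have [|k Kk xk] := cx (e / (`|C| + 1)); first by rewrite divr_gt0// ltr_wpDl.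
  have -> : phi x = phi (x - k) by rewrite phiD phiN Kk subr0.
  apply: le_trans (bnd _) _.
  apply: le_trans (_ : (`|C| + 1) * rnorm (x - k) <= _).
    by rewrite ler_wpM2r ?rnorm_ge0// (le_trans (ler_norm _))// lerDl.
  by rewrite mulrC -ler_pdivlMr ?ltr_wpDl// ltW.
have [h|/existsNP[x0 nx0]] := pselect (forall x, phi x = 0).
  by exists 0 => x; rewrite ip0r h.
have [p Kp hp] := orthogonal_projection x0 sK cK.
pose z := x0 - p; have pz : phi z != 0 by rewrite phiD phiN Kp subr0; apply/eqP.
have z0 : ip z z != 0.
  apply: contra_neq pz; rewrite ipxx => -[] /eqP; rewrite sqrf_eq0 => /eqP.
  by move=> /rnorm0_eq0 ->.
exists (Num.conj (phi z / ip z z) *: z) => x.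
have : ip z (x - (phi x / phi z) *: z) = 0.
  by apply: hp; rewrite /K/= phiD phiN phiZ divfK// subrr.
rewrite ipBr ipZr => /eqP; rewrite subr_eq0 => /eqP e.
rewrite ipZr cjK (ipC x z) e (cjM (Num.conj _)) cjK -ipC.
by field; rewrite pz z0.
Qed.

(** * Bounded operators from forms, inversion and closed images *)

Lemma mk_linear (f : V -> V) :
  (forall a x y, f (a *: x + y) = a *: f x + f y) ->
  exists T : {linear V -> V}, forall x, T x = f x.
Proof.
move=> lf; pose m := GRing.isLinear.Build R[i] V V *:%R f lf.
by exists (HB.pack_for {linear V -> V} f m).
Qed.

(** The form is conjugate-linear in its second variable, so Riesz is applied to the conjugate of
    [f x]. *)
Lemma form_operator (f : V -> V -> R[i]) (C : R) :
  sesquilinear_on setT f ->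
  (forall x y, rnorm (f x y) <= C * rnorm x * rnorm y) ->
  exists T : {linear V -> V}, forall x y, ip (T x) y = f x y.
Proof.
move=> [_ fl fr] bf.
have /choice[t ht] : forall x, exists t, forall y, Num.conj (f x y) = ip y t.
  move=> x; apply: (@riesz _ (C * rnorm x)) => [a u w|u].
    by rewrite fr// cjD cjM cjK.
  by rewrite rnorm_conj.
have hf x y : ip (t x) y = f x y by rewrite ipC -ht cjK.
have [|T hT] := @mk_linear t.
  by move=> a x y; apply: ip_ext => z; rewrite ipDl ipZl !hf fl.
by exists T => x y; rewrite hT hf.
Qed.

Lemma form_operator_le (T : {linear V -> V}) (C : R) :
  0 <= C -> (forall x y, rnorm (ip (T x) y) <= C * rnorm x * rnorm y) ->
  forall x, rnorm (T x) <= C * rnorm x.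
Proof.
move=> C0 h x; have := h x (T x).
have [->|n0] := eqVneq (rnorm (T x)) 0; first by rewrite mulr_ge0 ?rnorm_ge0.
have p : 0 < rnorm (T x) by rewrite lt_def n0 rnorm_ge0.
by rewrite ipxx rnormC ger0_norm ?sqr_ge0// expr2 ler_pM2r.
Qed.

Lemma bounded_continuous (T : {linear V -> V}) (C : R) :
  (forall x, rnorm (T x) <= C * rnorm x) -> continuous T.
Proof.
move=> h; apply/bounded_linear_continuous/linear_boundedP.
exists `|C|%:C; split; first by rewrite complex_real.
move=> M CM x.
have M0 : M = (complex.Re M)%:C.
  by rewrite RRe_real// gtr0_real// (le_lt_trans _ CM)// lecR.
move: CM; rewrite M0 ltcR => CM.
rewrite [leLHS]rnormE (rnormE x) -rmorphM lecR (le_trans (h x))//.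
by rewrite ler_wpM2r ?rnorm_ge0// (le_trans (ler_norm _))// ltW.
Qed.

Lemma continuous_bounded (T : {linear V -> V}) : continuous T ->
  exists2 C : R, 0 < C & forall x, rnorm (T x) <= C * rnorm x.
Proof.
move=> cT; have := @continuous_linear_bounded _ _ _ 0 T (cT 0).
move=> /linear_boundedP/pinfty_ex_gt0[r r0 h].
exists (complex.Re r); first by move: r0; rewrite ltcE => /andP[].
have rE : r = (complex.Re r)%:C by rewrite RRe_real// gtr0_real.
by move=> x; have := h x; rewrite rE [leLHS]rnormE (rnormE x) -rmorphM lecR.
Qed.

(** The lower bound gives injectivity and the norm of the inverse; the range is dense and closed,
    hence everything. In the application, symmetry of [W] turns orthogonality to the range into
    membership in the kernel. *)
Lemma symmetric_bijective (W : {linear V -> V}) (c : R) : 0 < c ->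
  (forall x, c * rnorm x <= rnorm (W x)) ->
  (forall y, (forall x, ip y (W x) = 0) -> y = 0) ->
  closed (range W) ->
  exists S : {linear V -> V}, [/\ forall x, W (S x) = x, forall x, S (W x) = x
    & forall x, rnorm (S x) <= c^-1 * rnorm x].
Proof.
move=> c0 lb h cl.
have inj x y : W x = W y -> x = y.
  move=> e; apply/eqP; rewrite -subr_eq0; apply/eqP/rnorm0_eq0/eqP.
  rewrite eq_le rnorm_ge0 andbT -(ler_pM2l c0) mulr0.
  by rewrite (le_trans (lb _))// linearB e subrr rnorm0.
have /choice[s hs] : forall y, exists x, W x = y.
  move=> y; have : closure (range W) y.
    rewrite closure_full//; first split.
    - by exists 0 => //; rewrite linear0.
    - by move=> a _ _ [u _ <-] [w _ <-]; exists (a *: u + w) => //; rewrite linearP.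
    - by move=> z hz; apply: h => x; apply: hz; exists x.
  by move/cl => [x _ <-]; exists x.
have [|S hS] := @mk_linear s.
  by move=> a x y; apply: inj; rewrite linearP !hs.
exists S; split=> x; first by rewrite hS hs.
  by apply: inj; rewrite hS hs.
by rewrite hS ler_pdivlMl// (le_trans (lb _))// hs.
Qed.

(** Preimages of an approximating sequence are Cauchy, because [T] is bounded below on [K]. *)
Lemma closed_image (K : set V) (T : {linear V -> V}) (C c : R) : 0 < c ->
  subspace_set K -> closed K ->
  (forall x, rnorm (T x) <= C * rnorm x) ->
  (forall x, K x -> c * rnorm x <= rnorm (T x)) -> closed (T @` K).
Proof.
move=> c0 sK cK bT lT y /closure_rnormP cy.
have /choice[u hu] : forall n : nat, exists x, K x /\ rnorm (y - T x) < n.+1%:R^-1.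
  move=> n; have [|_ [x Kx <-] h] := cy n.+1%:R^-1; first by rewrite invr_gt0.
  by exists x.
have [x hx] : exists l, forall e : R, 0 < e ->
    exists N, forall n, (N <= n)%N -> rnorm (l - u n) < e.
  apply: rnorm_complete => e e0.
  have [|N hN] := @small_inv (c * e / 2); first by rewrite divr_gt0// mulr_gt0.
  exists N => n m Nn Nm; rewrite -(ltr_pM2l c0).
  apply: le_lt_trans (lT _ (subspaceB sK (hu n).1 (hu m).1)) _.
  rewrite linearB; have := rnormD (T (u n) - y) (y - T (u m)).
  rewrite addrA subrK (rnormBC _ y); have := (hu n).2; have := (hu m).2.
  by have := hN _ Nn; have := hN _ Nm; move: n.+1%:R^-1 m.+1%:R^-1 => i j; lra.
exists x.
  apply: cK; apply/closure_rnormP => e e0; have [N hN] := hx e e0.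
  by exists (u N); [exact: (hu N).1|exact: hN].
apply/eqP; rewrite -subr_eq0; apply/eqP/rnorm0_eq0/eqP.
rewrite eq_le rnorm_ge0 andbT.
suff h (e : R) : 0 < e -> rnorm (T x - y) <= 0 + e by apply/ler_addgt0Pr.
move=> e0.
have C1 : 0 < `|C| + 1 by rewrite ltr_wpDl.
have [|N hN] := hx (e / 2 / (`|C| + 1)); first by rewrite !divr_gt0.
have [|M hM] := @small_inv (e / 2); first by rewrite divr_gt0.
pose n := maxn N M.
have := hN n (leq_maxl _ _); have := hM n (leq_maxr _ _).
have := (hu n).2; have := rnormD (T x - T (u n)) (T (u n) - y).
rewrite addrA subrK (rnormBC (T (u n)) y) -linearB.
have := bT (x - u n); have := ler_wpM2r (rnorm_ge0 (x - u n)) (ler_norm C).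
have := rnorm_ge0 (x - u n).
by rewrite (ltr_pdivlMr _ _ C1); move: n.+1%:R^-1 => i; lra.
Qed.

End Inner.

(** * Bounded functional calculus of a projection-valued measure *)

Section BoundedCalculus.
Context {R : realType} {V : completeNormedModType R[i]}.
Variable ip : {dot V for @Num.conj R[i]}.
Hypothesis hip : forall x : V, `|x| ^+ 2 = ip x x.
Variable E : pvm ip.
Local Notation TR := (measurableTypeR R).
Implicit Types (x y z : V) (f g h : TR -> R) (A : set TR).

Definition bmeas g :=
  measurable_fun setT g /\ exists C : R, forall t, `|g t| <= C.

Lemma bmeas_cst (c : R) : bmeas (fun=> c).
Proof. by split; [exact: measurable_cst|exists `|c|]. Qed.

Lemma bmeas_indic A : measurable A -> bmeas (\1_A : TR -> R).
Proof.
move=> mA; split; first exact: measurable_indic.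
by exists 1 => t; rewrite indicE; case: (_ \in _); rewrite ?normr1// normr0.
Qed.

Lemma bmeasD f g : bmeas f -> bmeas g -> bmeas (fun t => f t + g t).
Proof.
move=> [mf [C hC]] [mg [D hD]]; split; first exact: measurable_funD.
by exists (C + D) => t; rewrite (le_trans (ler_normD _ _))// lerD.
Qed.

Lemma bmeasM f g : bmeas f -> bmeas g -> bmeas (fun t => f t * g t).
Proof.
move=> [mf [C hC]] [mg [D hD]]; split; first exact: measurable_funM.
by exists (C * D) => t; rewrite normrM ler_pM.
Qed.

Lemma bmeasZ (c : R) g : bmeas g -> bmeas (fun t => c * g t).
Proof. by move=> bg; apply: bmeasM => //; exact: bmeas_cst. Qed.

(** Linearity over the reals only, so that the conjugate of such a functional is again one; the
    symmetry of integrals rests on this. *)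
Definition bfunctional (L : (TR -> R) -> R[i]) :=
  (forall (a : R) f g, bmeas f -> bmeas g ->
     L (fun t => a * f t + g t) = a%:C * L f + L g) /\
  exists2 K : R, 0 <= K & forall f (C : R), bmeas f -> (forall t, `|f t| <= C) ->
     rnorm (L f) <= K * C.

Lemma bfunctional_lin (a : R[i]) (L M : (TR -> R) -> R[i]) :
  bfunctional L -> bfunctional M -> bfunctional (fun f => a * L f + M f).
Proof.
move=> [lL [K K0 bL]] [lM [N N0 bM]]; split.
  by move=> c f g bf bg; rewrite lL// lM//; ring.
exists (rnorm a * K + N); first by rewrite addr_ge0// mulr_ge0// rnorm_ge0.
move=> f C bf fC; rewrite (le_trans (rnormD _ _))// mulrDl lerD//; last exact: bM.
by rewrite rnormM -mulrA ler_wpM2l ?rnorm_ge0// bL.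
Qed.

Lemma bfunctional0 : bfunctional (fun=> 0).
Proof.
split; first by move=> *; rewrite mulr0 addr0.
by exists 0 => // f C _ _; rewrite rnorm0 mul0r.
Qed.

Lemma bfunctionalZ (a : R[i]) (L : (TR -> R) -> R[i]) :
  bfunctional L -> bfunctional (fun f => a * L f).
Proof.
move=> bL; have := bfunctional_lin a bL bfunctional0.
by congr bfunctional; apply/funext => f; rewrite addr0.
Qed.

Lemma bfunctionalD (L M : (TR -> R) -> R[i]) :
  bfunctional L -> bfunctional M -> bfunctional (fun f => L f + M f).
Proof.
move=> bL bM; have := bfunctional_lin 1 bL bM.
by congr bfunctional; apply/funext => f; rewrite mul1r.
Qed.

Lemma bfunctionalM (L : (TR -> R) -> R[i]) g : bmeas g ->
  bfunctional L -> bfunctional (fun f => L (fun t => f t * g t)).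
Proof.
move=> bg [lL [K K0 bL]]; have [_ [C hC]] := bg; split.
  move=> a f h bf bh; rewrite -lL; [|exact: bmeasM..].
  by congr L; apply/funext => t; ring.
have C0 : 0 <= C by apply: le_trans (hC 0).
exists (K * C) => [|f D bf fD]; first exact: mulr_ge0.
rewrite -mulrA; apply: bL; first exact: bmeasM.
by move=> t; rewrite normrM mulrC ler_pM.
Qed.

(* A function with values in [0, 1] is half an indicator plus half another such
   function, so iterating bounds the functional by K / 2 ^ n. *)
Lemma bfunctional_eq0 L : bfunctional L ->
  (forall A, measurable A -> L (\1_A) = 0) -> forall f, bmeas f -> L f = 0.
Proof.
move=> [lL [K K0 bL]] L1.
have L0 : L (fun=> 0) = 0.
  have := lL (-1) (fun=> 0) (fun=> 0) (bmeas_cst _) (bmeas_cst _).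
  by rewrite mulr0 addr0 rmorphN1 mulN1r addNr.
have half n f : bmeas f -> (forall t, 0 <= f t <= 1) -> rnorm (L f) <= K / 2 ^+ n.
  elim: n f => [|n IH] f bf f01.
    rewrite expr0 divr1 -[leRHS]mulr1; apply: bL => // t.
    by have /andP[f0 f1] := f01 t; rewrite ger0_norm.
  pose A : set TR := f @^-1` `[2^-1, +oo[.
  have mA : measurable A.
    by rewrite -[A]setTI; apply: bf.1 => //; exact: measurable_itv.
  have AE t : \1_A t = ((2^-1 <= f t)%R : nat)%:R :> R.
    by rewrite indicE; congr (nat_of_bool _)%:R; apply/idP/idP; rewrite inE /A/= in_itv/= andbT.
  pose f' := fun t => 2 * f t + (-1) * \1_A t.
  have bf' : bmeas f'.
    by apply: bmeasD; apply: bmeasZ => //; exact: bmeas_indic.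
  have e : L f' = 2%:C * L f.
    rewrite /f' lL//; last by apply: bmeasZ; exact: bmeas_indic.
    rewrite (_ : L (fun t => -1 * \1_A t) = 0) ?addr0//.
    have := lL (-1) (\1_A) (fun=> 0) (bmeas_indic mA) (bmeas_cst _).
    by under eq_fun do rewrite addr0; rewrite L1// mulr0 L0 addr0.
  have := IH f' bf'; rewrite e rnormM rnormC ger0_norm// exprS invfM => h.
  have {h} : 2 * rnorm (L f) <= K / 2 ^+ n.
    apply: h => t; have /andP[f0 f1] := f01 t.
    by rewrite /f' AE; case: (leP 2^-1 (f t)) => ft /=; rewrite ?mulr1 ?mulr0;
      apply/andP; split; lra.
  by rewrite mulrCA => ?; rewrite ler_pdivlMl.
have L01 f : bmeas f -> (forall t, 0 <= f t <= 1) -> L f = 0.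
  move=> bf f01; apply/rnorm0_eq0/eqP; rewrite eq_le rnorm_ge0 andbT.
  rewrite leNgt; apply/negP => p.
  have K1 : 0 < K by have := half 0%N f bf f01; rewrite expr0 divr1; exact: lt_le_trans.
  have [n _ /(_ n)] := near_infty_natSinv_expn_lt (PosNum (divr_gt0 p K1)).
  move=> /(_ (leqnn _)) /=; rewrite ltr_pdivlMr// mulrC => h.
  by have := half n f bf f01; rewrite leNgt; move: h; rewrite div1r => ->.
move=> f bf; have [_ [C hC]] := bf.
have C0 : 0 <= C by apply: le_trans (hC 0).
(* With this [c], the function c f + 1/2 takes its values in [0, 1], where the first case
   applies. *)
pose c := (2 * (C + 1))^-1.
have c0 : 0 < c by rewrite invr_gt0; lra.
have cE : c * (2 * (C + 1)) = 1 by rewrite mulVf//; apply: lt0r_neq0; lra.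
have : L (fun t => c * f t + 2^-1) = 0.
  apply: L01; first by apply: bmeasD; [exact: bmeasZ|exact: bmeas_cst].
  move=> t; have := hC t; rewrite ler_norml => /andP[h1 h2].
  have : c * f t <= c * C by rewrite ler_pM2l.
  have : c * (- C) <= c * f t by rewrite ler_pM2l.
  by move=> h3 h4; apply/andP; split; lra.
rewrite lL//; last exact: bmeas_cst.
rewrite (L01 (fun=> 2^-1)); first last.
- by move=> _; apply/andP; split; lra.
- exact: bmeas_cst.
rewrite addr0 => /eqP; rewrite mulf_eq0 => /orP[/eqP[]/eqP|/eqP//].
by rewrite gt_eqF.
Qed.

(** The device behind the identities of the bounded calculus: it replaces convergence theorems by a
    check on spectral projections. *)
Lemma bfunctional_eq L M : bfunctional L -> bfunctional M ->
  (forall A, measurable A -> L (\1_A) = M (\1_A)) ->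
  forall f, bmeas f -> L f = M f.
Proof.
move=> bL bM LM f bf; apply/eqP; rewrite -subr_eq0; apply/eqP.
rewrite addrC -mulN1r.
apply: (@bfunctional_eq0 (fun f => -1 * M f + L f)) => //.
  exact: bfunctional_lin.
by move=> A mA; rewrite LM// mulN1r addNr.
Qed.

(** * Integrals of bounded functions and their operators *)

Lemma pvm_sym A x y : measurable A -> ip (E A x) y = ip x (E A y).
Proof. by move=> mA; exact: pvm_proj_sym. Qed.

Lemma pvm_idem A x : measurable A -> E A (E A x) = E A x.
Proof. by move=> mA; rewrite pvm_projI// setIid. Qed.

Lemma pvm_measT x : pvm_meas E x setT = (rnorm x ^+ 2)%:E.
Proof. by rewrite pvm_measE//= pvm_projT ipxx. Qed.

Lemma pvm_measE' x A : measurable A -> pvm_meas E x A = (rip ip (E A x) x)%:E.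
Proof. by move=> mA; rewrite pvm_measE. Qed.

Lemma bmeas_integrable g x : bmeas g -> (pvm_meas E x).-integrable setT (EFin \o g).
Proof.
move=> [mg [C hC]]; apply: measurable_bounded_integrable => //.
  by rewrite [X in (X < _)%E]pvm_measT ltry.
by exists C; split; [exact: num_real|move=> M CM t _; exact: le_trans (hC t) (ltW CM)].
Qed.

Definition qint g x : R := Rintegral (pvm_meas E x) setT g.

Lemma qint_le g x (C : R) : bmeas g -> (forall t, `|g t| <= C) ->
  `|qint g x| <= C * rnorm x ^+ 2.
Proof.
move=> bg hC; apply: le_trans (le_normr_Rintegral _ (bmeas_integrable x bg)) _ => //.
apply: le_trans (_ : Rintegral (pvm_meas E x) setT (fun=> C) <= _).
  apply: le_Rintegral => //.
  - apply: (@bmeas_integrable (fun t => `|g t|)).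
    split; last by exists C => t; rewrite normr_id.
    by apply: measurableT_comp => //; exact: bg.1.
  - by apply: (@bmeas_integrable (fun=> C)); exact: bmeas_cst.
by rewrite Rintegral_cst//= pvm_measT.
Qed.

Lemma qint_indic A x : measurable A -> qint (\1_A) x = rip ip (E A x) x.
Proof.
move=> mA; rewrite /qint /Rintegral integral_indic// setIT.
by rewrite pvm_measE'.
Qed.

Lemma bfunctional_qint x : bfunctional (fun g => (qint g x)%:C).
Proof.
split; last first.
  exists (rnorm x ^+ 2) => [|f C bf hC]; first exact: sqr_ge0.
  by rewrite rnormC mulrC qint_le.
move=> a f g bf bg; rewrite -rmorphM -rmorphD; congr (_%:C).
rewrite /qint RintegralD//; last 2 first.
- exact/(@bmeas_integrable (fun t => a * f t))/bmeasZ.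
- exact: bmeas_integrable.
by rewrite RintegralZl//; exact: bmeas_integrable.
Qed.

Lemma pvm_formE g x y : pvm_form E g x y =
  4^-1 * ((qint g (x + y))%:C + 'i%C * (qint g (x + 'i%C *: y))%:C
          - (qint g (x - y))%:C - 'i%C * (qint g (x - 'i%C *: y))%:C).
Proof.
rewrite /pvm_form !big_ord_recl big_ord0 /= -complexiE.
rewrite /bump/= ?addn0 ?add1n ?expr0 ?expr1.
rewrite [_ ^+ 3]exprS sqr_i mulrN1 !scaleNr !scale1r mul1r addr0.
by rewrite mulN1r mulNr !addrA.
Qed.

Lemma bfunctional_form x y : bfunctional (fun g => pvm_form E g x y).
Proof.
under eq_fun do rewrite pvm_formE -!mulNr -[- (qint _ (x - y))%:C]mulN1r.
have q := bfunctional_qint; have Z a L := @bfunctionalZ a L.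
exact: (Z _ _ (bfunctionalD (bfunctionalD (bfunctionalD (q _)
  (Z _ _ (q _))) (Z _ _ (q _))) (Z _ _ (q _)))).
Qed.

(** As [E A] is a symmetric idempotent, (E(A) z, z) is real; the real parts in the measures lose
    nothing, and polarization returns the complex form. *)
Lemma pvm_form_indic A x y : measurable A -> pvm_form E (\1_A) x y = ip (E A x) y.
Proof.
move=> mA; rewrite pvm_formE !qint_indic//.
have re z : (rip ip (E A z) z)%:C = ip (E A z) z.
  have e : ip (E A z) z = ip (E A z) (E A z) by rewrite -pvm_sym ?pvm_idem.
  by rewrite /rip e ipxx.
rewrite !re !(linearB (E A)) !(linearD (E A)) !(linearZ_LR (E A))/=.
rewrite !(ipDl, ipBl, ipDr, ipBr, ipZl, ipZr, ipNl, ipNr).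
have -> : Num.conj 'i%C = - 'i%C :> R[i] by apply/eqP; rewrite eq_complex/= oppr0 !eqxx.
have i2 : 'i%C * 'i%C = -1 :> R[i] by rewrite -expr2 sqr_i.
have n4 : (4 : R[i]) != 0 by rewrite pnatr_eq0.
apply: (mulfI n4); rewrite mulVKf//.
by ring: i2.
Qed.

(** With [g] varying and the vectors fixed, both sides of each identity are bounded functionals, and
    they agree on indicators. *)
Lemma pvm_form_sesquilinear g : bmeas g -> sesquilinear_on setT (pvm_form E g).
Proof.
move=> bg; split; first by [].
  move=> a u u' w _ _ _.
  apply: (@bfunctional_eq (fun g => pvm_form E g (a *: u + u') w)
    (fun g => a * pvm_form E g u w + pvm_form E g u' w)) => //.
  - exact: bfunctional_form.
  - by apply: bfunctional_lin; exact: bfunctional_form.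
  - by move=> A mA; rewrite !pvm_form_indic// linearP ipDl ipZl.
move=> a u w w' _ _ _.
apply: (@bfunctional_eq (fun g => pvm_form E g u (a *: w + w'))
  (fun g => Num.conj a * pvm_form E g u w + pvm_form E g u w')) => //.
- exact: bfunctional_form.
- by apply: bfunctional_lin; exact: bfunctional_form.
- by move=> A mA; rewrite !pvm_form_indic// ipDr ipZr.
Qed.

Lemma rnorm_quad (a b c d : R) :
  rnorm (4^-1 * (a%:C + 'i%C * b%:C - c%:C - 'i%C * d%:C)) <=
  4^-1 * (`|a| + `|b| + `|c| + `|d|).
Proof.
have ni : rnorm ('i%C : R[i]) = 1.
  by rewrite /rnorm normc_def/= expr0n/= add0r expr1n sqrtr1.
have n4 : rnorm (4^-1 : R[i]) = 4^-1.
  rewrite (_ : 4^-1 = (4^-1 : R)%:C) ?rnormC ?ger0_norm//.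
  by rewrite fmorphV rmorph_nat.
rewrite rnormM n4 ler_wpM2l//.
apply: le_trans (rnormD _ _) _; rewrite rnormN rnormM ni mul1r rnormC lerD2r.
apply: le_trans (rnormD _ _) _; rewrite rnormN rnormC lerD2r.
by apply: le_trans (rnormD _ _) _; rewrite rnormM ni mul1r !rnormC.
Qed.

(** Homogeneity reduces this to unit vectors; the four polarization vectors then have norm at most
    2, so each integral is at most 4 C, and so is a quarter of their sum. *)
Lemma pvm_form_bounded g : bmeas g -> exists2 K : R, 0 <= K &
  forall x y, rnorm (pvm_form E g x y) <= K * rnorm x * rnorm y.
Proof.
move=> bg; have [_ [C hC]] := bg; have [_ sl sr] := pvm_form_sesquilinear bg.
have C0 : 0 <= C by apply: le_trans (hC 0).
have l0 y : pvm_form E g 0 y = 0.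
  by have := sl (-1) 0 0 y I I I; rewrite scaler0 addr0 mulN1r addNr.
have r0 x : pvm_form E g x 0 = 0.
  by have := sr (-1) x 0 0 I I I; rewrite scaler0 addr0 rmorphN1 mulN1r addNr.
have Zl a x y : pvm_form E g (a *: x) y = a * pvm_form E g x y.
  by have := sl a x 0 y I I I; rewrite addr0 l0 addr0.
have Zr a x y : pvm_form E g x (a *: y) = Num.conj a * pvm_form E g x y.
  by have := sr a x y 0 I I I; rewrite addr0 r0 addr0.
have unit x y : rnorm x = 1 -> rnorm y = 1 -> rnorm (pvm_form E g x y) <= 4 * C.
  move=> x1 y1.
  have Q z : rnorm z <= 2 -> `|qint g z| <= 4 * C.
    move=> z2; rewrite (le_trans (qint_le z bg hC))// mulrC ler_wpM2r//.
    by rewrite (_ : 4 = 2 ^+ 2); [rewrite ler_pXn2r ?nnegrE ?rnorm_ge0|ring].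
  have ni : rnorm ('i%C : R[i]) = 1.
    by rewrite /rnorm normc_def/= expr0n/= add0r expr1n sqrtr1.
  have iy : rnorm ('i%C *: y) = 1 by rewrite rnormZ ni mul1r.
  have b2 (u w : V) : rnorm u = 1 -> rnorm w = 1 -> rnorm (u + w) <= 2.
    by move=> u1 w1; have := rnormD u w; rewrite u1 w1.
  have b2' (u w : V) : rnorm u = 1 -> rnorm w = 1 -> rnorm (u - w) <= 2.
    by move=> u1 w1; apply: b2; rewrite ?rnormN.
  rewrite pvm_formE; apply: le_trans (rnorm_quad _ _ _ _) _.
  have := Q _ (b2 _ _ x1 y1); have := Q _ (b2' _ _ x1 y1).
  have := Q _ (b2 _ _ x1 iy); have := Q _ (b2' _ _ x1 iy).
  by lra.
exists (4 * C) => [|x y]; first by rewrite mulr_ge0.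
have [x0|nx0] := eqVneq (rnorm x) 0.
  by rewrite x0 (rnorm0_eq0 x0) l0 rnorm0 mulr0 mul0r.
have [y0|ny0] := eqVneq (rnorm y) 0.
  by rewrite y0 (rnorm0_eq0 y0) r0 rnorm0 mulr0.
have nrm (z : V) : rnorm z != 0 -> rnorm ((rnorm z)^-1%:C *: z) = 1.
  by move=> nz; rewrite rnormZ rnormC ger0_norm ?invr_ge0 ?rnorm_ge0// mulVf.
have := unit _ _ (nrm _ nx0) (nrm _ ny0).
rewrite Zl Zr conjC_real !rnormM !rnormC !ger0_norm ?invr_ge0 ?rnorm_ge0//.
rewrite mulrA -invfM mulrC ler_pdivrMr; first by rewrite mulrA.
by rewrite mulr_gt0// lt_def ?nx0 ?ny0 rnorm_ge0.
Qed.

(* [pvm_op g] is the bounded operator \int g dE; it is meaningful only for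
   bounded measurable [g]. *)
Definition pvm_op g : {linear V -> V} :=
  xget (\0%R : {linear V -> V}) [set T | forall x y, ip (T x) y = pvm_form E g x y].

Lemma pvm_opE g x y : bmeas g -> ip (pvm_op g x) y = pvm_form E g x y.
Proof.
move=> bg; have [K _ hK] := pvm_form_bounded bg.
have [T hT] := form_operator hip (pvm_form_sesquilinear bg) hK.
by rewrite /pvm_op; case: xgetP => [S _ hS|/(_ T hT)//]; exact: hS.
Qed.

Lemma pvm_op_indic A x : measurable A -> pvm_op (\1_A) x = E A x.
Proof.
move=> mA; apply: (ip_ext hip) => z; rewrite pvm_opE ?pvm_form_indic//.
exact: bmeas_indic.
Qed.

Lemma pvm_op_lin (a : R) f g x : bmeas f -> bmeas g ->
  pvm_op (fun t => a * f t + g t) x = a%:C *: pvm_op f x + pvm_op g x.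
Proof.
move=> bf bg; apply: (ip_ext hip) => z.
rewrite ipDl ipZl !pvm_opE//; last exact/bmeasD/bg/bmeasZ.
exact: (bfunctional_form x z).1.
Qed.

Lemma pvm_op_sym g x y : bmeas g -> ip (pvm_op g x) y = ip x (pvm_op g y).
Proof.
move=> bg; rewrite [RHS]ipC !pvm_opE//.
apply: (@bfunctional_eq (fun g => pvm_form E g x y)
  (fun g => Num.conj (pvm_form E g y x))) => //.
- exact: bfunctional_form.
- have [lL [K K0 bL]] := bfunctional_form y x; split.
    by move=> a f h bf bh; rewrite lL// cjD cjM conjC_real.
  by exists K => // f C bf hC; rewrite rnorm_conj bL.
- by move=> A mA; rewrite !pvm_form_indic// -ipC pvm_sym.
Qed.

(** The factors are reduced to indicators one at a time, first [f], then [g]; for two indicators it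
    is the multiplicativity of [E]. *)
Lemma pvm_op_mul f g x : bmeas f -> bmeas g ->
  pvm_op f (pvm_op g x) = pvm_op (fun t => f t * g t) x.
Proof.
move=> bf bg; apply: (ip_ext hip) => z.
rewrite !pvm_opE//; last exact: bmeasM.
apply: (@bfunctional_eq (fun f => pvm_form E f (pvm_op g x) z)
  (fun f => pvm_form E (fun t => f t * g t) x z)) => //.
- exact: bfunctional_form.
- exact: (bfunctionalM bg (bfunctional_form x z)).
move=> A mA; rewrite pvm_form_indic// pvm_sym// pvm_opE//.
apply: (@bfunctional_eq (fun g => pvm_form E g x (E A z))
  (fun g => pvm_form E (fun t => \1_A t * g t) x z)) => //.
- exact: bfunctional_form.
- have := bfunctionalM (bmeas_indic mA) (bfunctional_form x z).
  congr bfunctional; apply/funext => h; congr pvm_form.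
  by apply/funext => t; rewrite mulrC.
move=> B mB; rewrite pvm_form_indic//.
have -> : (fun t => \1_A t * \1_B t) = \1_(A `&` B) :> (TR -> R).
  by rewrite indicI.
rewrite pvm_form_indic; last exact: measurableI.
by rewrite -pvm_projI// (@pvm_sym A _ z mA).
Qed.

Lemma qintE g x : bmeas g -> qint g x = rip ip (pvm_op g x) x.
Proof.
move=> bg; apply: complexI.
transitivity (ip (pvm_op g x) x); last first.
  by apply/esym/RRe_real; apply/CrealP; rewrite -ipC -pvm_op_sym.
rewrite pvm_opE//.
apply: (@bfunctional_eq (fun g => (qint g x)%:C) (fun g => pvm_form E g x x)) => //.
- exact: bfunctional_qint.
- exact: bfunctional_form.
move=> A mA; rewrite pvm_form_indic// qint_indic//.
have e : ip (E A x) x = ip (E A x) (E A x) by rewrite -pvm_sym ?pvm_idem.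
by rewrite /rip e ipxx.
Qed.

Lemma pvm_op_norm2 g x : bmeas g ->
  rnorm (pvm_op g x) ^+ 2 = qint (fun t => g t ^+ 2) x.
Proof.
move=> bg; rewrite qintE; last first.
  by under eq_fun do rewrite expr2; exact: bmeasM.
by rewrite -(ripxx hip) /rip -pvm_op_sym// pvm_op_mul.
Qed.

(** The sharp constant, now that |g(E) x|^2 is the integral of g^2; the Cayley step needs it to be a
    genuine contraction. *)
Lemma pvm_op_le g x (C : R) : bmeas g -> (forall t, `|g t| <= C) ->
  rnorm (pvm_op g x) <= C * rnorm x.
Proof.
move=> bg hC; have C0 : 0 <= C by apply: le_trans (hC 0).
rewrite -(ler_pXn2r (n := 2)) ?nnegrE ?mulr_ge0 ?rnorm_ge0// pvm_op_norm2//.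
rewrite exprMn; apply: le_trans (ler_norm _) _; apply: qint_le.
  by under eq_fun do rewrite expr2; exact: bmeasM.
by move=> t; rewrite normrX ler_pXn2r ?nnegrE.
Qed.

End BoundedCalculus.

(** * Unbounded functions *)

Section UnboundedCalculus.
Context {R : realType} {V : completeNormedModType R[i]}.
Variable ip : {dot V for @Num.conj R[i]}.
Hypothesis hip : forall x : V, `|x| ^+ 2 = ip x x.
Variable E : pvm ip.
Local Notation TR := (measurableTypeR R).
Implicit Types (x y z w : V) (f g h : TR -> R) (A : set TR).

(** For nested sets the squared norm of the difference is the difference of the measures of the
    sets, so continuity from below of the scalar measure suffices. *)
Lemma pvm_continuity (A : nat -> set TR) x :
  (forall n, measurable (A n)) -> (forall n m, (n <= m)%N -> A n `<=` A m) ->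
  forall e : R, 0 < e -> exists N, forall n, (N <= n)%N ->
  rnorm (E (\bigcup_n A n) x - E (A n) x) < e.
Proof.
move=> mA ndA e e0; pose U := \bigcup_n A n.
have mU : measurable U by exact: bigcupT_measurable.
have nd : {homo A : n m / (n <= m)%N >-> (n <= m)%O}.
  by move=> n m nm; apply/subsetPset; exact: ndA.
have nE B : measurable B -> rip ip (E B x) x = rnorm (E B x) ^+ 2.
  by move=> mB; rewrite -(ripxx hip) /rip -pvm_sym// pvm_idem.
have : (pvm_meas E x \o A) n @[n --> \oo] --> pvm_meas E x U.
  exact: nondecreasing_cvg_mu.
rewrite /comp pvm_measE'//; under eq_cvg do rewrite pvm_measE'//.
move=> /fine_cvgP[_]; rewrite /comp/= => /cvgrPdist_lt/(_ (e ^+ 2)).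
rewrite exprn_gt0// => /(_ isT)[N _ hN]; exists N => n Nn.
rewrite -(ltr_pXn2r (n := 2)) ?nnegrE ?rnorm_ge0//; last exact: ltW.
apply: le_lt_trans (hN n Nn); rewrite /= !nE//.
have e2 : rip ip (E U x) (E (A n) x) = rnorm (E (A n) x) ^+ 2.
  rewrite -{1}(pvm_idem E x (mA n)) ripC /rip (@pvm_sym _ _ _ E (A n))//.
  by rewrite pvm_projI// (setIidl (@bigcup_sup _ _ n setT A I))// -/(rip _ _ _) ripxx.
  by rewrite (rnormB2 hip) e2; apply: le_trans (ler_norm _); lra.
exact: mA.
Qed.

Definition lev g (n : nat) : set TR := [set t | `|g t| <= n.+1%:R].
Definition trunc g (n : nat) : TR -> R := fun t => \1_(lev g n) t * g t.

Lemma lev_measurable g n : measurable_fun setT g -> measurable (lev g n).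
Proof.
move=> mg; have -> : lev g n = (fun t => `|g t|) @^-1` `]-oo, n.+1%:R].
  by apply/seteqP; split => t /=; rewrite in_itv.
rewrite -[X in measurable X]setTI.
suff: measurable_fun setT (fun t : TR => `|g t| : R) by apply=> //; exact: measurable_itv.
exact: measurableT_comp.
Qed.

Lemma lev_nd g n m : (n <= m)%N -> lev g n `<=` lev g m.
Proof. by move=> nm t /= /le_trans; apply; rewrite ler_nat. Qed.

Lemma bigcup_lev g : \bigcup_n lev g n = setT.
Proof.
apply/seteqP; split => // t _; exists (Num.truncn `|g t|) => //=.
exact: ltW (truncnS_gt _).
Qed.

Lemma truncE g n t : trunc g n t = if `|g t| <= n.+1%:R then g t else 0.
Proof.
rewrite /trunc indicE; case: ifPn => h; first by rewrite mem_set ?mul1r.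
by rewrite memNset ?mul0r//; apply/negP.
Qed.

Lemma trunc_bmeas g n : measurable_fun setT g -> bmeas (trunc g n).
Proof.
move=> mg; split.
  by apply: measurable_funM => //; apply: measurable_indic; exact: lev_measurable.
by exists n.+1%:R => t; rewrite truncE; case: ifP => // _; rewrite normr0.
Qed.

Lemma cvg_lev g x : measurable_fun setT g ->
  forall e : R, 0 < e -> exists N, forall n, (N <= n)%N ->
  rnorm (x - E (lev g n) x) < e.
Proof.
move=> mg e e0; have := @pvm_continuity (lev g) x _ (@lev_nd g) e e0.
rewrite bigcup_lev pvm_projT; apply => n; exact: lev_measurable.
Qed.

Lemma bmeas_sqr g : bmeas g -> bmeas (fun t => g t ^+ 2).
Proof. by move=> bg; under eq_fun do rewrite expr2; exact: bmeasM. Qed.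

Lemma sqr_measurable g : measurable_fun setT g ->
  measurable_fun setT (fun t => g t ^+ 2).
Proof. by move=> mg; under eq_fun do rewrite expr2; exact: measurable_funM. Qed.

Lemma sqr_emeasurable g : measurable_fun setT g ->
  measurable_fun setT (fun t => (g t ^+ 2)%:E).
Proof. by move=> /sqr_measurable/measurable_EFinP. Qed.

(** Monotone convergence for the squares of the truncations. Boundedness of a sequence of linear
    images is visibly stable under linear combinations, which makes the domain a subspace. *)
Lemma pvm_fun_domP g x : measurable_fun setT g ->
  pvm_fun_dom E g x <->
  exists K : R, forall n, rnorm (pvm_op E (trunc g n) x) <= K.
Proof.
move=> mg; split=> [int|[K hK]].
  exists (Num.sqrt (qint E (fun t => g t ^+ 2) x)) => n.
  have bt := trunc_bmeas n mg.
  rewrite -(ger0_norm (rnorm_ge0 _)) -sqrtr_sqr ler_wsqrtr// pvm_op_norm2//.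
  apply: le_Rintegral => //.
    by apply: bmeas_integrable => //; exact: bmeas_sqr.
  move=> t _; rewrite truncE; case: ifP => // _.
  by rewrite expr0n/= sqr_ge0.
have ge0 t : (0 <= (g t ^+ 2)%:E)%E by rewrite lee_fin sqr_ge0.
apply/integrableP; split; first exact: sqr_emeasurable.
under eq_integral do rewrite gee0_abs//.
pose G n := fun t : TR => (trunc g n t ^+ 2)%:E.
have Gle n m t : (n <= m)%N -> (G n t <= G m t)%E.
  move=> nm; rewrite /G lee_fin !truncE; case: ifPn => h1.
    by rewrite (le_trans h1) ?ler_nat.
  by rewrite expr0n sqr_ge0.
have Gg t : limn (G ^~ t) = (g t ^+ 2)%:E.
  apply/cvg_lim => //; apply: cvg_near_cst.
  exists (Num.truncn `|g t|) => // n /= tn; rewrite /G truncE ifT//.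
  by rewrite (le_trans (ltW (truncnS_gt _)))// ler_nat.
under eq_integral do rewrite -Gg.
rewrite monotone_convergence//; first last.
- by move=> t _ n m nm; exact: Gle.
- by move=> n t _; rewrite lee_fin sqr_ge0.
- by move=> n; exact: (sqr_emeasurable (trunc_bmeas n mg).1).
apply: le_lt_trans (ltry (K ^+ 2)); apply: lime_le.
  apply: ereal_nondecreasing_is_cvgn => n m nm; apply: ge0_le_integral => //.
  - by move=> t _; rewrite lee_fin sqr_ge0.
  - exact: (sqr_emeasurable (trunc_bmeas n mg).1).
  - exact: (sqr_emeasurable (trunc_bmeas m mg).1).
  - by move=> t _; exact: Gle.
near=> n; have b2 := bmeas_sqr (trunc_bmeas n mg).
have fin := integrable_fin_num measurableT (bmeas_integrable hip E x b2).
rewrite -[leLHS](fineK fin) lee_fin.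
rewrite [leLHS](_ : _ = qint E (fun t => trunc g n t ^+ 2) x)//.
rewrite -pvm_op_norm2//; last exact: trunc_bmeas.
by rewrite ler_pXn2r ?nnegrE ?rnorm_ge0// (le_trans _ (hK 0%N)) ?rnorm_ge0.
Unshelve. all: by end_near. Qed.

Lemma pvm_fun_dom_lin g (a : R[i]) x y : measurable_fun setT g ->
  pvm_fun_dom E g x -> pvm_fun_dom E g y -> pvm_fun_dom E g (a *: x + y).
Proof.
move=> mg /(pvm_fun_domP _ mg)[K hK] /(pvm_fun_domP _ mg)[L hL].
apply/(pvm_fun_domP _ mg); exists (rnorm a * K + L) => n.
by rewrite linearP (le_trans (rnormD _ _))// lerD// rnormZ ler_wpM2l ?rnorm_ge0.
Qed.

Lemma dom_integrable g x : measurable_fun setT g -> pvm_fun_dom E g x ->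
  (pvm_meas E x).-integrable setT (EFin \o g).
Proof.
move=> mg dx; apply: (@le_integrable _ _ _ _ _ _ _ (fun t => (g t ^+ 2 + 1)%:E)) => //.
- exact/measurable_EFinP.
- move=> t _; rewrite !abse_EFin lee_fin [leRHS]ger0_norm ?addr_ge0 ?sqr_ge0//.
  suff : `|g t| <= `|g t| ^+ 2 + 1 by rewrite real_normK ?num_real.
  by move: `|g t| => r; have := sqr_ge0 (r - 1); have := sqr_ge0 r; rewrite sqrrB1; lra.
- under eq_fun do rewrite EFinD; apply: integrableD => //.
  by apply: (@bmeas_integrable _ _ _ hip E (fun=> 1)); exact: bmeas_cst.
Qed.

(** Off [lev g n] one has |g| > n + 1, hence |g| <= g^2 / (n + 1). *)
Lemma qint_trunc g x n : measurable_fun setT g -> pvm_fun_dom E g x ->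
  `|qint E g x - qint E (trunc g n) x| <=
  n.+1%:R^-1 * qint E (fun t => g t ^+ 2) x.
Proof.
move=> mg dx; have ig := dom_integrable mg dx.
have it := bmeas_integrable hip E x (trunc_bmeas n mg).
rewrite /qint -RintegralB//.
have idiff : (pvm_meas E x).-integrable setT (EFin \o (fun t => g t - trunc g n t)).
  exact: (integrableB measurableT ig it).
apply: le_trans (le_normr_Rintegral _ idiff) _ => //.
rewrite -RintegralZl//; apply: le_Rintegral => //.
- exact: integrable_norm.
- exact: (integrableZl measurableT n.+1%:R^-1 dx).
move=> t _; rewrite truncE; case: ifPn => [_|].
  by rewrite subrr normr0 mulr_ge0 ?sqr_ge0.
rewrite -ltNge subr0 => h; rewrite ler_pdivlMl// -(real_normK (num_real (g t))).
by rewrite expr2 ler_wpM2r// ltW.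
Qed.

(** The constant is the sum of the second moments at the four polarization vectors, which lie in the
    domain because it is a subspace. *)
Lemma pvm_form_trunc g x y : measurable_fun setT g ->
  pvm_fun_dom E g x -> pvm_fun_dom E g y ->
  exists K : R, forall n,
  rnorm (pvm_form E g x y - ip (pvm_op E (trunc g n) x) y) <= n.+1%:R^-1 * K.
Proof.
move=> mg dx dy; have dD a : pvm_fun_dom E g (x + a *: y).
  by rewrite addrC; exact: pvm_fun_dom_lin.
pose q2 := qint E (fun t => g t ^+ 2).
exists (q2 (x + 1 *: y) + q2 (x + 'i%C *: y) +
  q2 (x + (-1) *: y) + q2 (x + (- 'i%C) *: y)) => n.
rewrite pvm_opE//; last exact: trunc_bmeas.
have := qint_trunc n mg (dD 1); have := qint_trunc n mg (dD 'i%C).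
have := qint_trunc n mg (dD (-1)); have := qint_trunc n mg (dD (- 'i%C)).
rewrite !pvm_formE -!/(q2 _) scale1r scaleN1r scaleNr.
set a1 := qint E g _; set b1 := qint E (trunc _ _) _.
set a2 := qint E g _; set b2 := qint E (trunc _ _) _.
set a3 := qint E g _; set b3 := qint E (trunc _ _) _.
set a4 := qint E g _; set b4 := qint E (trunc _ _) _.
move=> h1 h2 h3 h4; rewrite -mulrBr (_ : _ - _ = (a4 - b4)%:C + 'i%C * (a3 - b3)%:C
  - (a2 - b2)%:C - 'i%C * (a1 - b1)%:C); last by rewrite !rmorphB/=; ring.
apply: le_trans (rnorm_quad _ _ _ _) _.
have := normr_ge0 (a4 - b4); have := normr_ge0 (a3 - b3).
have := normr_ge0 (a2 - b2); have := normr_ge0 (a1 - b1).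
by move: (n.+1%:R^-1) h1 h2 h3 h4 => i; lra.
Qed.

Lemma inv_le_eq0 {W : normedZmodType R[i]} (z : W) (K : R) :
  (forall n : nat, rnorm z <= n.+1%:R^-1 * K) -> z = 0.
Proof.
move=> h; apply/rnorm0_eq0/eqP; rewrite eq_le rnorm_ge0 andbT leNgt.
apply/negP => p.
have K0 : 0 < K by have := h 0%N; rewrite invr1 mul1r; exact: lt_le_trans.
have [N hN] := @small_inv R _ (divr_gt0 p K0).
have := h N; rewrite leNgt => /negP; apply.
by rewrite -ltr_pdivlMr// hN.
Qed.

Lemma pvm_form_herm g x y : measurable_fun setT g ->
  pvm_fun_dom E g x -> pvm_fun_dom E g y ->
  pvm_form E g x y = Num.conj (pvm_form E g y x).
Proof.
move=> mg dx dy; have [K hK] := pvm_form_trunc mg dx dy.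
have [L hL] := pvm_form_trunc mg dy dx.
apply/eqP; rewrite -subr_eq0; apply/eqP; apply: (@inv_le_eq0 R[i] _ (K + L)) => n.
have := hK n; have := hL n; rewrite -rnorm_conj cjD cjN -(ipC ip).
rewrite -pvm_op_sym//; last exact: trunc_bmeas.
rewrite rnormBC; set a := pvm_form E g x y; set b := Num.conj _; set c := ip _ _ => h1 h2.
have := rnormD (a - c) (c - b); rewrite addrA subrK mulrDr.
by move: (n.+1%:R^-1) h1 h2 => i; lra.
Qed.

Lemma pvm_proj_le A x : measurable A -> rnorm (E A x) <= rnorm x.
Proof.
move=> mA; rewrite -(pvm_op_indic hip)// -[leRHS]mul1r.
apply: (pvm_op_le hip); first exact: bmeas_indic.
by move=> t; rewrite indicE; case: (_ \in _); rewrite ?normr1// normr0.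
Qed.

(** Truncating [g] turns the composition into [E (lev g n) u]: bounded in n, so the vector lies in
    the domain, and convergent to u, so the value is u. *)
Lemma pvm_fun_op f g x : measurable_fun setT g -> bmeas f ->
  bmeas (fun t => g t * f t) ->
  pvm_fun E g (pvm_op E f x, pvm_op E (fun t => g t * f t) x).
Proof.
move=> mg bf bgf; set u := pvm_op E (fun t => g t * f t) x.
have tE n : pvm_op E (trunc g n) (pvm_op E f x) = E (lev g n) u.
  rewrite -(pvm_op_indic hip); last exact: lev_measurable.
  rewrite /u !(pvm_op_mul hip)//.
  - by congr (pvm_op E _ x); apply/funext => t; rewrite /trunc mulrA.
  - by apply: bmeas_indic; exact: lev_measurable.
  - exact: trunc_bmeas.
have d : pvm_fun_dom E g (pvm_op E f x).
  apply/(pvm_fun_domP _ mg); exists (rnorm u) => n; rewrite tE.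
  by apply: pvm_proj_le; exact: lev_measurable.
split=> //= w dw; have [K hK] := pvm_form_trunc mg d dw.
apply/eqP; rewrite -subr_eq0; apply/eqP/rnorm0_eq0/eqP.
rewrite eq_le rnorm_ge0 andbT leNgt; apply/negP.
set b := pvm_form E g _ _; set r := rnorm _ => r0.
have K1 : 0 < `|K| + 1 by rewrite ltr_wpDl.
have w1 : 0 < rnorm w + 1 by rewrite ltr_wpDl// rnorm_ge0.
have [|N hN] := @cvg_lev g u mg (r / 2 / (rnorm w + 1)).
  by rewrite !divr_gt0.
have [|M hM] := @small_inv R (r / 2 / (`|K| + 1)); first by rewrite !divr_gt0.
pose n := maxn N M.
have := hN n (leq_maxl _ _); have := hM n (leq_maxr _ _); have := hK n.
rewrite tE -/b; set v := E (lev g n) u.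
have : rnorm (ip u w - ip v w) <= rnorm (u - v) * rnorm w.
  by rewrite -ipBl; exact: ip_le.
have := rnormD (ip u w - ip v w) (ip v w - b).
rewrite addrA subrK -/r (rnormBC (ip v w)).
have n0 : 0 < n.+1%:R^-1 :> R by rewrite invr_gt0.
rewrite !ltr_pdivlMr//; move: (n.+1%:R^-1) n0 => i i0.
have : i * K <= i * `|K| by rewrite ler_wpM2l ?ler_norm// ltW.
by have := rnorm_ge0 (u - v); lra.
Qed.

Lemma pvm_fun_sym g x y x' y' : measurable_fun setT g ->
  pvm_fun E g (x, y) -> pvm_fun E g (x', y') -> ip y x' = ip x y'.
Proof.
move=> mg [/= dx hx] [/= dx' hx']; rewrite hx//.
rewrite (ipC ip x) (hx' _ dx); exact: pvm_form_herm.
Qed.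

End UnboundedCalculus.

(** * Spectral gap, sign and inverse square root *)

Section Spectral.
Context {R : realType} {V : completeNormedModType R[i]}.
Variable ip : {dot V for @Num.conj R[i]}.
Hypothesis hip : forall x : V, `|x| ^+ 2 = ip x x.
Variable E : pvm ip.
Local Notation TR := (measurableTypeR R).
Implicit Types (x y z w : V) (f g h : TR -> R) (A : set TR).

Lemma pvm_projU A B x : measurable A -> measurable B -> A `&` B = set0 ->
  E (A `|` B) x = E A x + E B x.
Proof.
move=> mA mB AB; have bA := bmeas_indic mA; have bB := bmeas_indic mB.
have := pvm_op_lin hip E 1 x bA bB.
rewrite rmorph1 scale1r (pvm_op_indic hip E x mA) (pvm_op_indic hip E x mB) => <-.
rewrite -(pvm_op_indic hip E x (measurableU _ _ mA mB)).
congr (pvm_op E _ x); apply/funext => t; rewrite mul1r !indicE in_setU.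
case: (boolP (t \in A)) => tA; case: (boolP (t \in B)) => tB /=;
  rewrite ?addr0 ?add0r//.
have : (A `&` B) t by move: tA tB; rewrite !inE.
by rewrite AB.
Qed.

Lemma pvm_proj0 x : E set0 x = 0.
Proof.
have := @pvm_projU set0 set0 x measurable0 measurable0 (setI0 _).
by rewrite setU0 => /eqP; rewrite -[X in X == _]addr0 (inj_eq (addrI _)) => /eqP.
Qed.

Lemma pvm_projC A x : measurable A -> E (~` A) x = x - E A x.
Proof.
move=> mA; have := @pvm_projU A (~` A) x mA (measurableC mA) (setICr _).
by rewrite setUCr pvm_projT => {2}->; rewrite addrC addKr.
Qed.

(** On the range of E([-e, e]) the operator has norm at most e, while the bounded inverse gives |x|
    <= C |H x|; with e = 1 / (2 C) only x = 0 remains. Used for both H_0 and H. *)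
Lemma pvm_gap (H : set (V * V)) : spectral_measure_of E H -> resolvent_set H 0 ->
  exists2 e : R, 0 < e & forall x, E `[- e, e]%classic x = 0.
Proof.
move=> hE [T [/continuous_bounded[C C0 hC] hT]].
pose e := (2 * C)^-1; have e0 : 0 < e by rewrite invr_gt0 mulr_gt0.
exists e => // x; pose A : set TR := `[- e, e]%classic.
have mA : measurable A by exact: measurable_itv.
have bA := bmeas_indic mA.
have leA t : `|t * \1_A t| <= e.
  rewrite indicE; case: (boolP (t \in A)) => tA; last by rewrite mulr0 normr0 ltW.
  by rewrite mulr1 ler_norml; move: tA; rewrite inE /A/= in_itv.
have bi : bmeas (fun t : TR => (t : R) * \1_A t).
  by split; [apply: measurable_funM => //; exact: bA.1|exists e].
have := @pvm_fun_op _ _ _ hip E (\1_A) idfun x (@measurable_id _ _ _) bA bi.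
rewrite hE (pvm_op_indic hip E x mA); set y := pvm_op _ _ _; set x' := E A x => Hx.
have yle : rnorm y <= e * rnorm x'.
  have -> : y = pvm_op E (fun t : TR => (t : R) * \1_A t) x'.
    rewrite /x' -(pvm_op_indic hip E x mA) (pvm_op_mul hip E x bi bA).
    by congr (pvm_op E _ x); apply/funext => t; rewrite !indicE;
      case: (_ \in _); rewrite ?mulr0 ?mulr1.
  exact: pvm_op_le.
have xT : x' = T y by apply/(hT x' y).1; exists y => //; rewrite scale0r subr0.
apply/rnorm0_eq0/eqP; rewrite eq_le rnorm_ge0 andbT -/A -/x'.
have := hC y; rewrite -xT => h.
have : C * rnorm y <= C * (e * rnorm x') by rewrite ler_pM2l.
have -> : C * (e * rnorm x') = 2^-1 * rnorm x'.
  by rewrite /e; field; rewrite gt_eqF.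
by lra.
Qed.

Lemma pvm_sub0 A B x : measurable A -> measurable B -> A `<=` B ->
  (forall y, E B y = 0) -> E A x = 0.
Proof.
move=> mA mB AB h; have := pvm_projI E mA mB x.
by rewrite h linear0 (setIidl AB).
Qed.

Definition posR : set TR := `]0, +oo[%classic.
Definition negR : set TR := `]-oo, 0[%classic.

Lemma mpos : measurable posR.
Proof. exact: measurable_itv. Qed.
Lemma mneg : measurable negR.
Proof. exact: measurable_itv. Qed.
Lemma pos_projE x : pos_proj E x = E posR x. Proof. by []. Qed.
Lemma neg_projE x : neg_proj E x = E negR x. Proof. by []. Qed.

(** The complement of the two half-lines is {0}, which lies inside the gap. *)
Lemma pos_neg_proj (e : R) x : 0 < e -> (forall y, E `[- e, e]%classic y = 0) ->
  pos_proj E x + neg_proj E x = x.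
Proof.
move=> e0 h; rewrite pos_projE neg_projE.
have d : posR `&` negR = set0.
  by apply/seteqP; split => t //; rewrite /posR /negR/= !in_itv/= andbT => -[]; lra.
rewrite -(pvm_projU _ mpos mneg d) -[RHS](pvm_projT E).
have mU : measurable (posR `|` negR).
  by apply: measurableU; [exact: mpos|exact: mneg].
apply/eqP; rewrite eq_sym -subr_eq0 pvm_projT -pvm_projC//; apply/eqP.
apply: (@pvm_sub0 _ `[- e, e]%classic) => //; first exact: measurableC.
move=> t /= /not_orP[]; rewrite /posR /negR/= !in_itv/= andbT => /negP + /negP.
by rewrite -!leNgt => ? ?; apply/andP; split; lra.
Qed.

Lemma sgE : (Num.sg : TR -> R) = fun t => (-1) * \1_negR t + \1_posR t.
Proof.
apply/funext => t; rewrite !indicE /posR /negR !mem_setE !in_itv/= andbT.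
by case: sgrP => [_|t0|t0]; rewrite ?ltxx ?t0 ?(lt_gtF t0)/= ?mulr0 ?addr0 ?mulr1 ?add0r.
Qed.

Lemma sign_opE z : op_app (sign_op E) z = pos_proj E z - neg_proj E z.
Proof.
have bn := bmeas_indic mneg; have bp := bmeas_indic mpos.
have bs : bmeas (Num.sg : TR -> R) by rewrite sgE; exact: (bmeasD (bmeasZ _ bn) bp).
have dom w : pvm_fun_dom E (Num.sg : TR -> R) w.
  by apply: (bmeas_integrable hip); exact: bmeas_sqr.
have h : sign_op E (z, pvm_op E (Num.sg : TR -> R) z).
  split=> [|w _]; [exact: dom|exact: (pvm_opE hip _ _ _ bs)].
rewrite /op_app; case: xgetP => [y _ /= [_ /= hy]|/(_ _ h)//].
have -> : y = pvm_op E (Num.sg : TR -> R) z.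
  by apply: (ip_ext hip) => w; rewrite hy// (pvm_opE hip _ _ _ bs).
rewrite sgE (pvm_op_lin hip E (-1) z bn bp).
rewrite [X in _ + X](pvm_op_indic hip E z mpos) [X in _ *: X + _](pvm_op_indic hip E z mneg).
by rewrite rmorphN1 scaleN1r addrC pos_projE neg_projE.
Qed.

(** [B] integrates |t|^{-1/2} cut off to the complement of the gap. Its product with |t|^{1/2} is
    the indicator of a set whose projection is the identity, so each (B y, y) is in the graph;
    pairing an arbitrary point of the graph with these gives the converse. *)
Lemma sqrt_abs_inverse (e : R) : 0 < e -> (forall y, E `[- e, e]%classic y = 0) ->
  exists B : {linear V -> V},
  [/\ forall x y, ip (B x) y = ip x (B y),
      exists2 C : R, 0 < C & forall x, rnorm (B x) <= C * rnorm x,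
      forall x, B (pos_proj E x) = pos_proj E (B x) /\
                B (neg_proj E x) = neg_proj E (B x),
      forall x, B x = 0 -> x = 0
    & forall x y, sqrt_abs E (x, y) <-> x = B y].
Proof.
move=> e0 h; pose A : set TR := ~` `[- e, e]%classic.
have mA : measurable A by apply: measurableC; exact: measurable_itv.
have bA := bmeas_indic mA.
have EA x : E A x = x by rewrite pvm_projC// h subr0.
pose g := fun t : TR => Num.sqrt `|t| : R.
have gE : g = fun t : TR => `|t : R| `^ 2^-1.
  by apply/funext => t; rewrite powR12_sqrt.
have mabs : measurable_fun setT (fun t : TR => `|t : R|) by exact: measurableT_comp.
have mg : measurable_fun setT g.
  by rewrite gE; apply: (measurableT_comp (measurable_powR _)).
pose b := fun t : TR => `|t : R| `^ (- 2^-1) * \1_A t.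
have Alt t : A t -> e < `|t|.
  by rewrite /A/= in_itv/= -ler_norml => /negP; rewrite -ltNge.
have bb : bmeas b.
  split.
    apply: measurable_funM; last exact: bA.1.
    exact: (measurableT_comp (measurable_powR _)).
  exists (e `^ 2^-1)^-1 => t; rewrite /b indicE.
  case: (boolP (t \in A)) => tA; last by rewrite mulr0 normr0 invr_ge0 powR_ge0.
  have {tA}/Alt tA : A t by rewrite inE in tA.
  rewrite mulr1 ger0_norm ?powR_ge0// powRN lef_pV2 ?posrE ?powR_gt0//.
    by apply: ge0_ler_powR; rewrite ?nnegrE//; exact: ltW.
  exact: lt_trans tA.
have gb : (fun t => g t * b t) = \1_A :> (TR -> R).
  apply/funext => t; rewrite gE /b indicE; case: (boolP (t \in A)) => tA; last by rewrite !mulr0.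
  have {tA}/Alt tA : A t by rewrite inE in tA.
  by rewrite mulr1 powRN mulfV// gt_eqF// powR_gt0// (lt_trans e0).
pose B := pvm_op E b; exists B.
have Bsym x y : ip (B x) y = ip x (B y) by exact: pvm_op_sym.
have SB y : sqrt_abs E (B y, y).
  have := @pvm_fun_op _ _ _ hip E b g y mg bb.
  by rewrite gb => /(_ bA); rewrite (pvm_op_indic hip E y mA) EA.
have comm P x : measurable P -> B (E P x) = E P (B x).
  move=> mP; have bP := bmeas_indic mP.
  rewrite -(pvm_op_indic hip E x mP) -(pvm_op_indic hip E (B x) mP).
  rewrite (pvm_op_mul hip E x bb bP) (pvm_op_mul hip E x bP bb).
  by congr (pvm_op E _ x); apply/funext => t; rewrite mulrC.
split => //.
- have [_ [C hC]] := bb; exists (`|C| + 1) => [|x]; first by rewrite ltr_wpDl.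
  have := pvm_op_le hip E x bb hC; have := ler_wpM2r (rnorm_ge0 x) (ler_norm C).
  by have := rnorm_ge0 x; rewrite -/B; lra.
- by move=> x; split; apply: comm; [exact: mpos|exact: mneg].
- move=> x Bx; apply: (ip_ext hip) => z; rewrite ip0l.
  (* If B x = 0, truncations of |t|^{1/2} applied to B x vanish; these are the vectors
     [E (lev g n) x], which converge to x. *)
  have lim n : E (lev g n) x = 0.
    have bl := trunc_bmeas n mg; have ml := lev_measurable n mg.
    have bm := bmeas_indic ml.
    rewrite -[x]EA -(pvm_op_indic hip E x mA) -gb -(pvm_op_indic hip E _ ml).
    have bgb : bmeas (fun t => g t * b t) by rewrite gb.
    rewrite (pvm_op_mul hip E x bm bgb).
    have := pvm_op_mul hip E x bl bb; rewrite -/B Bx linear0 => e1.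
    rewrite [RHS]e1; congr (pvm_op E _ x); apply/funext => t.
    by rewrite /trunc mulrA.
  have -> : x = 0; last by rewrite ip0l.
  apply/rnorm0_eq0/eqP; rewrite eq_le rnorm_ge0 andbT leNgt; apply/negP => p.
  have [N /(_ N (leqnn _))] := cvg_lev hip E x mg p.
  by rewrite lim subr0 ltxx.
- move=> x y; split=> [Sxy|->]; last exact: SB.
  apply: (ip_ext hip) => z; rewrite Bsym.
  exact/esym/(pvm_fun_sym hip mg Sxy (SB z)).
Qed.

End Spectral.

(** * A Lyapunov inequality *)

Section Lyapunov.
Context {R : realType} {V : completeNormedModType R[i]}.
Variable ip : {dot V for @Num.conj R[i]}.
Hypothesis hip : forall x : V, `|x| ^+ 2 = ip x x.
Variable E : pvm ip.
Local Notation TR := (measurableTypeR R).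
Implicit Types (x y z w : V) (f g h : TR -> R) (A : set TR).

Lemma geometric_ge0 (a K r : R) : 0 <= r -> r < 1 ->
  (forall k : nat, - (K * r ^+ k) <= a) -> 0 <= a.
Proof.
move=> r0 r1 h; rewrite leNgt; apply/negP => a0.
have K1 : 0 < `|K| + 1 by rewrite ltr_wpDl.
have : (fun k => r ^+ k) @ \oo --> (0 : R) by apply: cvg_expr; rewrite ger0_norm.
move=> /cvgrPdist_lt/(_ (- a / (`|K| + 1))); rewrite divr_gt0 ?oppr_gt0//.
move=> /(_ isT)[N _ /(_ N (leqnn N))] /=; rewrite sub0r normrN ger0_norm ?exprn_ge0//.
rewrite ltr_pdivlMr//; have := h N.
have := ler_wpM2r (exprn_ge0 N r0) (ler_norm K); have := exprn_ge0 N r0.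
by move: (r ^+ N) => t; lra.
Qed.

(** The sign [s] selects the half-line. With N = n + 1, on the band |1 - s t| / |1 + s t| <= (N - 1)
    / (N + 1) = n / (n + 2), the contraction factor of a Cayley step. *)
Definition band (s : R) (n : nat) : set TR :=
  [set t : TR | n.+1%:R^-1 <= s * (t : R) <= n.+1%:R].

Lemma band_measurable s n : measurable (band s n).
Proof.
have -> : band s n = (fun t : TR => s * (t : R)) @^-1` `[n.+1%:R^-1, n.+1%:R].
  by apply/seteqP; split => t; rewrite /band/= in_itv.
rewrite -[X in measurable X]setTI.
suff: measurable_fun setT (fun t : TR => s * (t : R)).
  by apply=> //; exact: measurable_itv.
by apply: measurable_funM => //; exact: measurable_cst.
Qed.

Lemma band_nd s n m : (n <= m)%N -> band s n `<=` band s m.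
Proof.
move=> nm t /= /andP[h1 h2]; apply/andP; split.
  by rewrite (le_trans _ h1)// lef_pV2 ?posrE// ler_nat.
by rewrite (le_trans h2)// ler_nat.
Qed.

Lemma bigcup_band s : \bigcup_n band s n = [set t : TR | 0 < s * (t : R)].
Proof.
apply/seteqP; split => [t [n _ /= /andP[h _]]|t /= h].
  by apply: lt_le_trans h; rewrite invr_gt0.
have [N hN] := small_inv h.
exists (maxn N (Num.truncn (s * (t : R)))) => //; apply/andP; split.
  by apply/ltW/hN/leq_maxl.
by rewrite ltW// (lt_le_trans (truncnS_gt _))// ler_nat ltnS leq_maxr.
Qed.

Variables (G : {linear V -> V}) (K : R).
Hypothesis symG : forall x y, rip ip (G x) y = rip ip x (G y).
Hypothesis bndG : forall x, rnorm (G x) <= K * rnorm x.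

(* One Cayley step x -> (1 - sH)(1 + sH)^-1 x decreases the form of G by
   4 Re (Gz, sHz) with x = z + sHz, and contracts the range of [E (band s n)]. *)
Lemma cayley_step (s : R) n : s * s = 1 ->
  (forall u w, pvm_fun E idfun (u, w) -> 0 <= s * rip ip w (G u)) ->
  let q : R := n%:R / n.+2%:R in
  forall x, E (band s n) x = x -> exists x', [/\ E (band s n) x' = x',
    rip ip (G x') x' <= rip ip (G x) x & rnorm x' <= q * rnorm x].
Proof.
move=> ss hH q x hx; pose A := band s n; have mA := band_measurable s n.
have bA := bmeas_indic mA.
(* The indicator cuts away the pole of 1 / (1 + s t). *)
pose f := fun t : TR => \1_A t * (1 + s * (t : R)) `^ (-1).
have fE t : A t -> f t * (1 + s * (t : R)) = 1.
  move=> At; rewrite /f indicE mem_set// mul1r.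
  have /andP[h1 h2] := At.
  have p : 0 < 1 + s * (t : R) by rewrite ltr_wpDr// (le_trans _ h1).
  by rewrite powR_inv1 ?ltW// mulVf// gt_eqF.
have f0 t : ~ A t -> f t = 0 by move=> At; rewrite /f indicE memNset// mul0r.
have mid : measurable_fun setT (fun t : TR => (t : R)) by exact: measurable_id.
have mf : measurable_fun setT f.
  apply: measurable_funM; first exact: bA.1.
  apply: (measurableT_comp (measurable_powR _)).
  apply: measurable_funD; first exact: measurable_cst.
  by apply: measurable_funM => //; exact: measurable_cst.
have f01 t : 0 <= f t <= 1.
  have [At|/f0 ->] := pselect (A t); last by rewrite lexx ler01.
  have /andP[h1 h2] := At; have := fE _ At.
  have : 0 <= s * (t : R) by rewrite (le_trans _ h1).
  move: (s * (t : R)) (f t) => r y r0 e.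
  have y0 : 0 < y by rewrite -(pmulr_lgt0 (x := 1 + r)) ?e//; lra.
  by apply/andP; split; nra.
have bf : bmeas f.
  split=> //; exists 1 => t; have /andP[? ?] := f01 t.
  by rewrite ger0_norm.
pose h := fun t : TR => (t : R) * f t.
have sh t : s * h t = \1_A t - f t.
  rewrite /h indicE; have [At|At] := pselect (A t).
    by rewrite mem_set//=; have := fE _ At; lra.
  by rewrite memNset// f0// !mulr0 subr0.
have bh : bmeas h.
  have -> : h = fun t => s * (\1_A t + (-1) * f t).
    by apply/funext => t; rewrite mulN1r -sh mulrA ss mul1r.
  by apply: bmeasZ; apply: bmeasD => //; exact: bmeasZ.
(* Here z = (1 + sH)^-1 x and w = H z, so that x = z + s w and its Cayley image is z - s w. *)
pose z := pvm_op E f x; pose w := pvm_op E h x.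
have Hzw : pvm_fun E idfun (z, w) by exact: (pvm_fun_op hip E x mid bf bh).
have xE : x = s%:C *: w + z.
  rewrite -{1}hx -(pvm_op_indic hip E x mA) -(pvm_op_lin hip E s x bh bf).
  by congr (pvm_op E _ x); apply/funext => t; rewrite sh subrK.
have xE' : pvm_op E (fun t => (- s) * h t + f t) x = - (s%:C *: w) + z.
  by rewrite (pvm_op_lin hip E (- s) x bh bf) rmorphN scaleNr.
pose c := fun t => (- s) * h t + f t.
have bc : bmeas c by apply: bmeasD => //; exact: bmeasZ.
exists (pvm_op E c x); split.
- rewrite -(pvm_op_indic hip E _ mA) (pvm_op_mul hip E x bA bc).
  congr (pvm_op E _ x); apply/funext => t; rewrite /c indicE.
  have [At|At] := pselect (A t); first by rewrite mem_set// mul1r.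
  by rewrite memNset// /h f0// !mulr0 addr0 mul0r.
- have := hH _ _ Hzw; rewrite -ripZl xE'.
  suff aux v z' y : y = v + z' -> 0 <= rip ip v (G z') ->
      rip ip (G (- v + z')) (- v + z') <= rip ip (G y) y by exact: aux.
  move=> -> h0.
  rewrite !(linearD G) !(linearN G)/= !(ripDl, ripDr, ripNl, ripNr).
  by rewrite (symG v z') (ripC ip (G z') v); lra.
- apply: (pvm_op_le hip) => // t; rewrite /c mulNr sh.
  have [At|At] := pselect (A t); last first.
    rewrite indicE memNset// f0// subr0 oppr0 addr0 normr0 /q.
    by rewrite divr_ge0.
  (* On the band the multiplier is 2 y - 1 with y = 1 / (1 + r), r = s t; the two sides of 1 / N <=
     r <= N bound it from above and below. *)
  rewrite indicE mem_set//; have /andP[h1 h2] := At; have := fE _ At.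
  have := f01 t; move: (s * (t : R)) (f t) h1 h2 => r y h1 h2 /andP[y0 y1] e.
  have n2 : 0 < n.+2%:R :> R by [].
  have N1 : 0 < n.+1%:R :> R by [].
  have h3 : 1 <= r * n.+1%:R by rewrite -ler_pdivrMr// div1r.
  have nE : n.+2%:R = n.+1%:R + 1 :> R by rewrite -natr1.
  have nE' : n%:R = n.+1%:R - 1 :> R by rewrite -natr1 addrK.
  rewrite /q ler_norml -mulNr ler_pdivlMr// ler_pdivrMr// nE nE'.
  move: (n.+1%:R : R) N1 h2 h3 => N N1 h2 h3 {n2 nE nE'}.
  have {e} ye : y * r = 1 - y by lra.
  have a1 : y * (r * N) >= y by rewrite ler_peMr.
  have a2 : y * r <= y * N by rewrite ler_wpM2l.
  have a3 : y * (r * N) = N - y * N by rewrite mulrA ye mulrBl mul1r.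
  by rewrite mulr1n; apply/andP; split; lra.
Qed.

(** Within one band, k Cayley steps only lower the form while shrinking the vector by q^k, so the
    form is at least -|K| q^{2k} |x|^2 for every k. The bands exhaust the half-line and the form is
    continuous. *)
Lemma lyapunov (s : R) : s * s = 1 ->
  (forall u w, pvm_fun E idfun (u, w) -> 0 <= s * rip ip w (G u)) ->
  forall x, E [set t : TR | 0 < s * (t : R)] x = x -> 0 <= rip ip (G x) x.
Proof.
move=> ss hH x hx.
have K0 : 0 <= `|K| by [].
have bndG' y : rnorm (G y) <= `|K| * rnorm y.
  by rewrite (le_trans (bndG y))// ler_wpM2r ?rnorm_ge0 ?ler_norm.
have pos n y : E (band s n) y = y -> 0 <= rip ip (G y) y.
  pose q : R := n%:R / n.+2%:R.
  have q0 : 0 <= q by rewrite divr_ge0.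
  have q1 : q < 1 by rewrite ltr_pdivrMr// mul1r ltr_nat.
  have q21 : q ^+ 2 < 1 by rewrite expr_lt1.
  move=> hy; apply: (@geometric_ge0 _ (`|K| * rnorm y ^+ 2) (q ^+ 2)) => //.
    exact: sqr_ge0.
  move=> k; elim: k y hy => [|k IH] y hy.
    rewrite expr0 mulr1 lerNl -ripNr; apply: le_trans (rip_le hip _ _) _.
    by rewrite rnormN expr2 mulrA ler_wpM2r ?rnorm_ge0.
  have [y' [hy' le1 le2]] := @cayley_step s n ss hH y hy.
  apply: le_trans le1; apply: le_trans (IH _ hy').
  rewrite lerN2 (exprS (q ^+ 2)) [leRHS]mulrA ler_wpM2r ?exprn_ge0 ?sqr_ge0// -mulrA ler_wpM2l//.
  by rewrite mulrC -exprMn ler_pXn2r ?nnegrE ?mulr_ge0 ?rnorm_ge0.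
rewrite leNgt; apply/negP => neg.
(* The form at x and at its band component y differ by at most 2 |K| |x| |x - y|; the added 1 keeps
   the denominator positive. *)
pose d := - rip ip (G x) x / (2 * `|K| * rnorm x + 1).
have D0 : 0 < 2 * `|K| * rnorm x + 1 by rewrite ltr_wpDl// !mulr_ge0 ?rnorm_ge0.
have d0 : 0 < d by rewrite divr_gt0// oppr_gt0.
have [N /(_ N (leqnn N))] := pvm_continuity hip E x (band_measurable s) (@band_nd s) d0.
rewrite bigcup_band hx; set y := E (band s N) x => xy.
have Ey : E (band s N) y = y by exact: (pvm_idem E x (band_measurable s N)).
have yx : rnorm y <= rnorm x by apply: (pvm_proj_le hip); exact: band_measurable.
have := pos _ _ Ey.
have e : rip ip (G x) x = rip ip (G (x - y)) x + rip ip (G y) (x - y) + rip ip (G y) y.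
  by rewrite linearB ripBl ripBr; lra.
have h1 : - rip ip (G (x - y)) x <= `|K| * rnorm (x - y) * rnorm x.
  rewrite -ripNr; apply: le_trans (rip_le hip _ _) _.
  by rewrite rnormN ler_wpM2r ?rnorm_ge0.
have h2 : - rip ip (G y) (x - y) <= `|K| * rnorm x * rnorm (x - y).
  rewrite -ripNr; apply: le_trans (rip_le hip _ _) _.
  rewrite rnormN ler_wpM2r ?rnorm_ge0// (le_trans (bndG' y))// ler_wpM2l//.
have : rnorm (x - y) * (2 * `|K| * rnorm x + 1) < - rip ip (G x) x.
  by rewrite -ltr_pdivlMr.
have := rnorm_ge0 (x - y); move: e; lra.
Qed.

End Lyapunov.

(** * The operator associated with a form *)

Section FormOperator.
Context {R : realType} {V : completeNormedModType R[i]}.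
Variable ip : {dot V for @Num.conj R[i]}.
Hypothesis hip : forall x : V, `|x| ^+ 2 = ip x x.
Variables (S : set (V * V)) (B W Wi : {linear V -> V}) (h : V -> V -> R[i]).
Variables (CB CW : R).
Hypothesis CB0 : 0 < CB.
Hypothesis CW0 : 0 < CW.
Hypothesis Bsym : forall x y, ip (B x) y = ip x (B y).
Hypothesis Bbnd : forall x, rnorm (B x) <= CB * rnorm x.
Hypothesis Binj : forall x, B x = 0 -> x = 0.
Hypothesis SB : forall x y, S (x, y) <-> x = B y.
Hypothesis Wsym : forall x y, ip (W x) y = ip x (W y).
Hypothesis WK : forall x, W (Wi x) = x.
Hypothesis WiK : forall x, Wi (W x) = x.
Hypothesis Wibnd : forall x, rnorm (Wi x) <= CW * rnorm x.
Hypothesis hE : forall x y, h (B x) (B y) = ip (W x) y.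
Implicit Types (x y u w z : V).

Lemma op_dom_graph : op_dom S = range B.
Proof.
by apply/seteqP; split => [x [y /SB ->]|_ [y _ <-]]; exists y => //; apply/SB.
Qed.

Lemma op_app_graph x : op_app S (B x) = x.
Proof.
rewrite /op_app; case: xgetP => [y _ /SB e|/(_ x)]; last by case; apply/SB.
apply/esym/eqP; rewrite -subr_eq0; apply/eqP/Binj.
by rewrite linearB e subrr.
Qed.

Lemma op_app_inv_graph x : op_app (op_inv S) x = B x.
Proof.
rewrite /op_app; case: xgetP => [y _ /SB/= ->|/(_ (B x))] //.
by case; apply/SB.
Qed.

Lemma Wisym x y : ip (Wi x) y = ip x (Wi y).
Proof. by rewrite -{1}(WK y) -Wsym WK. Qed.

Definition form_inv x : V := B (Wi (B x)).
Definition form_op : set (V * V) := [set p | p.1 = form_inv p.2].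

Lemma form_inv_sym x y : ip (form_inv x) y = ip x (form_inv y).
Proof. by rewrite /form_inv Bsym Wisym Bsym. Qed.

Lemma form_inv_eq0 x : form_inv x = 0 -> x = 0.
Proof.
move=> /Binj e; apply: Binj; rewrite -(WK (B x)) e.
exact: linear0.
Qed.

Lemma form_inv_lin a x y : form_inv (a *: x + y) = a *: form_inv x + form_inv y.
Proof. by rewrite /form_inv !linearP. Qed.

Lemma form_op_operator : is_operator form_op.
Proof.
split.
- by rewrite /form_op/= /form_inv !linear0.
- by move=> a x y x' y'; rewrite /form_op/= => -> ->; rewrite form_inv_lin.
- move=> x y y'; rewrite /form_op/= => -> e.
  apply/eqP; rewrite -subr_eq0; apply/eqP/form_inv_eq0.
  have := form_inv_lin (-1) y' y; rewrite !scaleN1r -e addNr => <-.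
  by rewrite addrC.
Qed.

Lemma form_op_dom : op_dom form_op = range form_inv.
Proof.
by apply/seteqP; split => [x [y]|_ [y _ <-]]; [rewrite /form_op/= => ->|]; exists y.
Qed.

Lemma form_op_dense : densely_defined form_op.
Proof.
rewrite /densely_defined form_op_dom; apply: (closure_full hip).
  split; first by exists 0 => //; rewrite /form_inv !linear0.
  move=> a _ _ [x _ <-] [y _ <-]; exists (a *: x + y) => //.
  exact: form_inv_lin.
move=> y hy; apply: form_inv_eq0; apply: (ip_ext hip) => z.
by rewrite form_inv_sym hy ?ip0l//; exists z.
Qed.

(** [form_inv] is symmetric and defined everywhere, so a point of the adjoint may be tested against
    (form_inv z, z) for every z. *)
Lemma form_op_adjoint : op_adjoint ip form_op = form_op.
Proof.
apply/seteqP; split => -[x y] /=.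
  rewrite /op_adjoint/= => H.
  apply: (ip_ext hip) => z /=; rewrite form_inv_sym.
  by rewrite ipC (H (form_inv z) z)// -ipC.
rewrite /form_op/= => -> u w /= ->.
by rewrite form_inv_sym.
Qed.

Lemma form_op_self_adjoint : self_adjoint ip form_op.
Proof.
split; [exact: form_op_operator|exact: form_op_dense|exact: form_op_adjoint].
Qed.

Lemma form_inv_bnd x : rnorm (form_inv x) <= CB * (CW * CB) * rnorm x.
Proof.
rewrite /form_inv (le_trans (Bbnd _))// -!mulrA ler_pM2l//.
by rewrite (le_trans (Wibnd _))// ler_pM2l.
Qed.

Lemma closed_graph (f : V -> V) (C : R) : 0 < C ->
  (forall x y, f (x - y) = f x - f y) ->
  (forall x, rnorm (f x) <= C * rnorm x) ->
  forall G : set (V * V), (forall x y, G (x, y) <-> x = f y) -> closed G.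
Proof.
move=> C0 fB fC G Gf [x y] cG; apply/Gf/eqP; rewrite -subr_eq0.
apply/eqP/rnorm0_eq0/eqP; rewrite eq_le rnorm_ge0 andbT leNgt; apply/negP => p.
set r := rnorm _ in p; pose e := r / 2 / (C + 1).
have C1 : 0 < C + 1 by rewrite ltr_wpDl// ltW.
have e0 : 0 < e by rewrite !divr_gt0.
have er : e * (C + 1) = r / 2 by rewrite divfK// gt_eqF.
have [|[u w] [/Gf uw]] := cG (ball (x, y) e%:C).
  by apply: nbhsx_ballx; rewrite ltr0c.
move=> -[/=]; rewrite -!ball_normE/= !rnormE !ltcR => h1 h2.
have : r <= rnorm (x - u) + rnorm (u - f y).
  by have := rnormD (x - u) (u - f y); rewrite addrA subrK.
rewrite uw -fB; have := fC (w - y); rewrite (rnormBC w).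
have : C * rnorm (y - w) <= C * e by rewrite ler_pM2l// ltW.
have : C * e + e = r / 2 by rewrite -er; ring.
by rewrite -uw; lra.
Qed.

Lemma form_op_closed : closed form_op.
Proof.
apply: (@closed_graph form_inv (CB * (CW * CB))) => //.
- by rewrite !mulr_gt0.
- by move=> x y; rewrite /form_inv !linearB.
- exact: form_inv_bnd.
Qed.

Lemma form_op_form u w z : form_op (u, w) -> op_dom S z -> ip w z = h u z.
Proof.
rewrite op_dom_graph /form_op/= => -> [y _ <-].
by rewrite /form_inv hE WK Bsym.
Qed.

Lemma form_op_associated : associated ip form_op (op_dom S) h.
Proof.
have sub : op_dom form_op `<=` op_dom S.
  by rewrite form_op_dom op_dom_graph => _ [y _ <-]; exists (Wi (B y)).
split => //; rewrite ?form_op_adjoint.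
- exact: form_op_operator.
- exact: form_op_closed.
- exact: form_op_dense.
- by [].
- split=> [u y w Huy Sw|u w y]; first exact: form_op_form.
  rewrite op_dom_graph /form_op/= => -[x _ <-] ->.
  by rewrite /form_inv hE Wsym WK -Bsym.
Qed.

(** If u = B x and H u = y, testing with B z gives W x = B y, that is, H is contained in [form_op].
    Taking adjoints reverses the inclusion, and both operators are their own adjoints. *)
Lemma form_op_unique H : self_adjoint ip H -> associated ip H (op_dom S) h ->
  form_op = H.
Proof.
move=> [_ _ saH] [_ _ _ [dH _] [hH _]].
have sub : H `<=` form_op.
  move=> [u y] Huy; have : op_dom S u by apply: dH; exists y.
  rewrite op_dom_graph => -[x _ xu]; rewrite /form_op/= /form_inv -xu; congr (B _).
  rewrite -[LHS]WiK; congr (Wi _); apply: (ip_ext hip) => z.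
  by rewrite -hE xu Bsym (hH _ _ _ Huy)// op_dom_graph; exists z.
apply/seteqP; split => // -[x y].
rewrite -{1}form_op_adjoint -saH /op_adjoint/= => K u w Huw.
by apply: K; exact: sub.
Qed.

Lemma form_op_resolvent : resolvent_set form_op 0.
Proof.
have [A hA] := mk_linear form_inv_lin.
exists A; split.
  by apply: (@bounded_continuous _ _ A (CB * (CW * CB))) => x; rewrite hA form_inv_bnd.
move=> x y; rewrite hA; split=> [[w]|->].
  by rewrite /form_op/= => -> ->; rewrite scale0r subr0.
by exists y => //; rewrite scale0r subr0.
Qed.

(** Points of the graph of [S] are (B z, z), and those over the domain of the operator have z in the
    range of W^-1 B. That range is dense: y orthogonal to it satisfies B W^-1 y = 0. *)
Lemma form_op_core : op_core (op_dom form_op) S.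
Proof.
split.
- rewrite form_op_dom; split; first by exists 0 => //; rewrite /form_inv !linear0.
  move=> a _ _ [x _ <-] [y _ <-]; exists (a *: x + y) => //.
  exact: form_inv_lin.
- by rewrite form_op_dom op_dom_graph => _ [y _ <-]; exists (Wi (B y)).
apply/seteqP; split.
  have cS : closed S.
    apply: (@closed_graph B CB) => //; first exact: linearB.
  by apply: subset_trans (closure_subset _) cS => p [].
move=> [_ z] /SB ->.
pose K : set V := range (fun y => Wi (B y)).
have /seteqP[_ /(_ z I) cz] : closure K = setT.
  apply: (closure_full hip).
    split; first by exists 0 => //; rewrite !linear0.
    by move=> a _ _ [x _ <-] [y _ <-]; exists (a *: x + y); rewrite ?linearP.
  move=> y hy; rewrite -(WK y) (_ : Wi y = 0) ?linear0//; apply: Binj.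
  apply: (ip_ext hip) => t; rewrite Bsym Wisym hy ?ip0l//.
  by exists t.
move: cz => /closure_rnormP cz.
move=> U /nbhs_ballP[e /= e0 eU].
have eE : e = (complex.Re e)%:C by rewrite RRe_real// gtr0_real.
have re0 : 0 < complex.Re e by rewrite -ltr0c -eE.
have B1 : 0 < CB + 1 by rewrite ltr_wpDl// ltW.
have [|k [t _ <-] tk] := cz (complex.Re e / (CB + 1)); first by rewrite divr_gt0.
have {}tk : rnorm (z - Wi (B t)) * (CB + 1) < complex.Re e by rewrite -ltr_pdivlMr.
exists (form_inv t, Wi (B t)); split.
  by split; [apply/SB|exists t].
have n0 := rnorm_ge0 (z - Wi (B t)).
have m0 : 0 <= rnorm (z - Wi (B t)) * CB by rewrite mulr_ge0// ltW.
apply: eU; split => /=; rewrite -ball_normE/= rnormE eE ltcR.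
  by rewrite /form_inv -linearB; have := Bbnd (z - Wi (B t)); lra.
by lra.
Qed.

End FormOperator.

(** * Graph subspaces and angles *)

Section Trigonometry.
Context {R : realType}.

(** Replaces the two angles by their sines and cosines, leaving only polynomial inequalities; the
    angle condition becomes positivity of C c - S nu, the cosine of the sum. *)
Lemma tan_atan_asin (tau nu : R) : 0 <= tau -> 0 <= nu -> nu < 1 ->
  atan tau + asin nu < pi / 2 ->
  exists C S c : R, [/\ 0 < C, S = tau * C, 0 < c, c ^+ 2 + nu ^+ 2 = 1 &
    0 < C * c - S * nu /\
    tan (atan tau + asin nu) = (S * c + C * nu) / (C * c - S * nu)].
Proof.
move=> t0 n0 n1 h; have Cgt : 0 < cos (atan tau).
  by apply: cos_gt0_pihalf; rewrite atan_gtNpi2 atan_ltpi2.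
have SE : sin (atan tau) = tau * cos (atan tau).
  by rewrite -{2}(atanK tau) /tan divfK// gt_eqF.
have nu11 : -1 <= nu <= 1 by apply/andP; split; lra.
have sE : sin (asin nu) = nu by rewrite asinK// in_itv.
have cE : cos (asin nu) = Num.sqrt (1 - nu ^+ 2) by exact: cos_asin.
have n21 : 0 < 1 - nu ^+ 2 by rewrite subr_gt0 expr_lt1.
exists (cos (atan tau)), (sin (atan tau)), (cos (asin nu)); split => //.
- by rewrite cE sqrtr_gt0.
- by rewrite -{2}sE cos2Dsin2.
have at0 : 0 <= atan tau.
  by move: t0; rewrite le_eqVlt => /orP[/eqP <-|/lt_atan/ltW]; rewrite atan0.
have asN : - (pi / 2) < asin nu by apply: asin_gtNpi2; apply/andP; split; lra.
have <- : sin (atan tau + asin nu) = sin (atan tau) * cos (asin nu) + cos (atan tau) * nu.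
  by rewrite sinD sE.
have <- : cos (atan tau + asin nu) = cos (atan tau) * cos (asin nu) - sin (atan tau) * nu.
  by rewrite cosD sE.
split=> //; apply: cos_gt0_pihalf; rewrite h andbT.
by rewrite (lt_le_trans asN)// lerDr.
Qed.

(* With C = cos a, S = sin a, nu = sin b, c = cos b and (u, w) = n (cos d, sin d),
   d <= b, this reads sin (a + d) <= sin (a + b) and cos (a + b) <= cos (a + d). *)
Lemma rotate_le (C S c nu n u w : R) : 0 < C -> 0 <= S -> 0 < c -> 0 <= nu ->
  c ^+ 2 + nu ^+ 2 = 1 -> 0 < C * c - S * nu ->
  0 <= n -> 0 <= u -> 0 <= w -> u ^+ 2 + w ^+ 2 = n ^+ 2 -> w <= nu * n ->
  C * w + S * u <= (S * c + C * nu) * n /\ (C * c - S * nu) * n <= C * u - S * w.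
Proof.
move=> C0 S0 c0 nu0 cn1 d0 n0 u0 w0 e wn.
have k0 : 0 <= c * n by rewrite mulr_ge0// ltW.
have e2 : (c * n) ^+ 2 + (nu * n) ^+ 2 = u ^+ 2 + w ^+ 2.
  by rewrite e !exprMn -mulrDl cn1 mul1r.
have uk : c * n <= u.
  rewrite -(ler_pXn2r (n := 2)) ?nnegrE//.
  have : w ^+ 2 <= (nu * n) ^+ 2 by rewrite ler_pXn2r ?nnegrE ?mulr_ge0.
  by move: e2; lra.
have Sw : S * w <= S * (nu * n) by rewrite ler_wpM2l.
have Cu : C * (c * n) <= C * u by rewrite ler_pM2l.
have Ck : S * (nu * n) <= C * (c * n).
  have : 0 <= (C * c - S * nu) * n by rewrite mulr_ge0// ltW.
  by lra.
split; last by lra.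
move: (c * n) (nu * n) k0 e2 uk Sw Cu Ck wn (mulr_ge0 nu0 n0) (mulrA S c n) (mulrA C nu n).
move=> k m k0 e2 uk Sw Cu Ck wn m0 e3 e4.
rewrite mulrDl -e3 -e4.
(* After multiplication by u + k and u^2 - k^2 = m^2 - w^2, what is left is S (m + w) <= C (u + k),
   from S m <= C k and S w <= C u. *)
suff : S * (u - k) <= C * (m - w) by lra.
have [uk0|uk0] := eqVneq (u + k) 0.
  have -> : u = k by lra.
  by rewrite subrr mulr0 mulr_ge0 ?subr_ge0// ltW.
have ukp : 0 < u + k by rewrite lt_def uk0 addr_ge0.
rewrite -(ler_pM2r ukp).
have -> : S * (u - k) * (u + k) = S * (m + w) * (m - w).
  transitivity (S * (u ^+ 2 - k ^+ 2)); first by ring.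
  have -> : u ^+ 2 - k ^+ 2 = m ^+ 2 - w ^+ 2 by lra.
  by ring.
by rewrite [leRHS]mulrAC ler_wpM2r ?subr_ge0//; lra.
Qed.

End Trigonometry.

(** * Pairs of complementary orthogonal projections *)

Section OrthogonalPair.
Context {R : realType} {V : completeNormedModType R[i]}.
Variable ip : {dot V for @Num.conj R[i]}.
Hypothesis hip : forall x : V, `|x| ^+ 2 = ip x x.

Definition orthogonal_pair (P P' : {linear V -> V}) : Prop :=
  [/\ forall x, P x + P' x = x, forall x y, ip (P x) y = ip x (P y),
      forall x, P (P x) = P x & forall x, P (P' x) = 0].

Lemma orthogonal_pairC P P' : orthogonal_pair P P' -> orthogonal_pair P' P.
Proof.
move=> [hs sym id o].
have e x : P' x = x - P x by rewrite -{2}(hs x) addrC addKr.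
split.
- by move=> x; rewrite addrC.
- by move=> x y; rewrite !e ipBl ipBr sym.
- by move=> x; rewrite [LHS]e o subr0.
- by move=> x; rewrite e id subrr.
Qed.

Variables P P' : {linear V -> V}.
Hypothesis PP : orthogonal_pair P P'.

Lemma pair_ip x y : ip (P x) (P' y) = 0.
Proof. by case: PP => _ sym _ o; rewrite sym o ip0r. Qed.

Lemma pair_norm x : rnorm x ^+ 2 = rnorm (P x) ^+ 2 + rnorm (P' x) ^+ 2.
Proof.
have [hs _ _ _] := PP.
by rewrite -{1}(hs x) (rnormD2 hip) /rip pair_ip mulr0 addr0.
Qed.

Lemma pair_le x : rnorm (P x) <= rnorm x.
Proof.
rewrite -(ler_pXn2r (n := 2)) ?nnegrE ?rnorm_ge0// (pair_norm x) lerDl.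
exact: sqr_ge0.
Qed.

Lemma pair_range x : range P x <-> P x = x.
Proof.
have [_ _ id _] := PP.
by split=> [[y _ <-]|e]; [rewrite id|exists x].
Qed.

Lemma pair_range_subspace : subspace_set (range P).
Proof.
split; first by exists 0 => //; rewrite linear0.
by move=> a _ _ [u _ <-] [w _ <-]; exists (a *: u + w) => //; rewrite linearP.
Qed.

Lemma pair_range_closed : closed (range P).
Proof.
move=> x /closure_rnormP cx; apply/pair_range/eqP; rewrite -subr_eq0.
apply/eqP/rnorm0_eq0/eqP; rewrite eq_le rnorm_ge0 andbT leNgt; apply/negP => p.
have [|k /pair_range Pk xk] := cx (rnorm (P x - x) / 2); first by rewrite divr_gt0.
have := rnormD (P (x - k)) (k - x); rewrite linearB Pk addrA subrK.
have := pair_le (x - k); rewrite linearB Pk (rnormBC k).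
by lra.
Qed.

End OrthogonalPair.

(** * Subspaces as graphs over the ranges of oblique projections *)

Section Graph.
Context {R : realType} {V : completeNormedModType R[i]}.
Variable ip : {dot V for @Num.conj R[i]}.
Hypothesis hip : forall x : V, `|x| ^+ 2 = ip x x.
Variables (P P' Q Q' T T' : {linear V -> V}) (tau nu : R).
Hypothesis PP : orthogonal_pair ip P P'.
Hypothesis QQ : orthogonal_pair ip Q Q'.
Hypothesis TT : complementary_projections T T'.
Hypothesis tau0 : 0 <= tau.
Hypothesis nu0 : 0 <= nu.
Hypothesis nu1 : nu < 1.
Hypothesis angle : atan tau + asin nu < pi / 2.
Hypothesis PT : forall x, rnorm (P x - T x) <= nu * rnorm x.
Hypothesis PT' : forall x, rnorm (P' x - T' x) <= nu * rnorm x.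
Hypothesis angleQ : forall x, Q x = x -> rnorm (P' x) <= tau * rnorm (P x).
Hypothesis angleQ' : forall x, Q' x = x -> rnorm (P x) <= tau * rnorm (P' x).
Implicit Types x y : V.

Local Notation bound := (tan (atan tau + asin nu)).

Lemma bound_ge0 : 0 <= bound.
Proof.
have [C [S [c [C0 SE c0 cn [d0 ->]]]]] := tan_atan_asin tau0 nu0 nu1 angle.
apply: divr_ge0; last exact: ltW.
by rewrite SE addr_ge0 ?mulr_ge0// ltW.
Qed.

Lemma TT'0 x : T (T' x) = 0.
Proof.
have [_ _ idT _ hs] := TT; have := hs x => /(congr1 T).
by rewrite linearD idT => e; apply: (addrI (T x)); rewrite e addr0.
Qed.

Lemma T'T0 x : T' (T x) = 0.
Proof.
have [_ _ _ idT hs] := TT; have := hs x => /(congr1 T').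
by rewrite linearD idT => e; apply: (addIr (T' x)); rewrite e add0r.
Qed.

(** With a = T x and b = T' x, [rotate_le] bounds (C c - S nu) |b| by C |P' b| - S |P b|, and C |P'
    a| + S |P a| by (S c + C nu) |a|. The inequality |P' x| <= tau |P x| for x = a + b, with C tau =
    S, links the two. *)
Lemma graph_angle x : Q x = x -> rnorm (T' x) <= bound * rnorm (T x).
Proof.
move=> Qx; have [C [S [c [C0 SE c0 cn [d0 ->]]]]] := tan_atan_asin tau0 nu0 nu1 angle.
have S0 : 0 <= S by rewrite SE mulr_ge0// ltW.
have [_ _ idT idT' hs] := TT.
set a := T x; set b := T' x.
have Pa : rnorm (P' a) <= nu * rnorm a.
  by have := PT' a; rewrite T'T0 subr0.
have Pb : rnorm (P b) <= nu * rnorm b.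
  by have := PT b; rewrite TT'0 subr0.
have [h1 _] := rotate_le C0 S0 c0 nu0 cn d0 (rnorm_ge0 a) (rnorm_ge0 (P a))
  (rnorm_ge0 (P' a)) (esym (pair_norm hip PP a)) Pa.
have e2 : rnorm (P' b) ^+ 2 + rnorm (P b) ^+ 2 = rnorm b ^+ 2.
  by rewrite addrC -(pair_norm hip PP).
have [_ h2] := rotate_le C0 S0 c0 nu0 cn d0 (rnorm_ge0 b) (rnorm_ge0 (P' b))
  (rnorm_ge0 (P b)) e2 Pb.
have h3 : rnorm (P' b) <= rnorm (P' x) + rnorm (P' a).
  have -> : P' b = P' x - P' a by rewrite -linearB -{1}(hs x) addrC addKr.
  by rewrite (le_trans (rnormD _ _))// rnormN.
have h4 : rnorm (P x) <= rnorm (P a) + rnorm (P b).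
  by rewrite -{1}(hs x) linearD rnormD.
have h5 := angleQ Qx.
have h6 : C * rnorm (P' b) <= C * (tau * (rnorm (P a) + rnorm (P b)) + rnorm (P' a)).
  rewrite ler_pM2l// (le_trans h3)// lerD2r (le_trans h5)//.
  by rewrite ler_wpM2l.
rewrite mulrAC ler_pdivlMr//.
have -> : rnorm b * (C * c - S * nu) = (C * c - S * nu) * rnorm b by rewrite mulrC.
apply: le_trans h2 _; apply: le_trans h1; move: h6; rewrite SE.
by lra.
Qed.

(** Source of injectivity, of closedness of the image and of continuity of the inverse. *)
Lemma graph_lower x : Q x = x -> rnorm x <= (1 + bound) * rnorm (T x).
Proof.
move=> Qx; have [_ _ _ _ hs] := TT; rewrite -{1}(hs x).
rewrite (le_trans (rnormD _ _))// mulrDl mul1r lerD2l.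
exact: graph_angle.
Qed.

(** Orthogonality to the range of T' gives (y, T x) = (y, x), so y lies in the range of Q'. Moreover
    |P' y|^2 = (y, (T - P) P' y), whence |P' y| <= nu |y|; with |P y| <= tau |P' y| this yields
    |y|^2 <= (1 + tau^2) nu^2 |y|^2. *)
Lemma graph_orthogonal y : (forall x, Q x = x -> ip y (T x) = 0) ->
  (forall x, ip y (T' x) = 0) -> y = 0.
Proof.
move=> h h'; have [_ _ _ _ hs] := TT.
have yT x : ip y (T x) = ip y x by rewrite -{2}(hs x) ipDr h' addr0.
have [C [S [c [C0 SE c0 cn [d0 _]]]]] := tan_atan_asin tau0 nu0 nu1 angle.
have [_ symQ idQ _] := QQ; have [_ _ _ oQ'] := orthogonal_pairC QQ.
have Qy : Q y = 0.
  by apply: (ip_ext hip) => z; rewrite symQ -yT h// ip0l.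
have Q'y : Q' y = y by have [hQ _ _ _] := QQ; rewrite -{2}(hQ y) Qy add0r.
have [_ symP' idP' _] := orthogonal_pairC PP; have [_ _ _ oP] := PP.
have P'y : rnorm (P' y) <= nu * rnorm y.
  have [->|n0] := eqVneq (rnorm (P' y)) 0; first by rewrite mulr_ge0 ?rnorm_ge0.
  have p : 0 < rnorm (P' y) by rewrite lt_def n0 rnorm_ge0.
  rewrite -(ler_pM2r p) -expr2 -(ripxx hip).
  have -> : rip ip (P' y) (P' y) = rip ip y (T (P' y) - P (P' y)).
    by rewrite /rip oP subr0 yT symP' idP'.
  apply: le_trans (rip_le hip _ _) _; rewrite mulrC mulrAC ler_wpM2r ?rnorm_ge0//.
  by rewrite rnormBC PT.
have := angleQ' Q'y; have := pair_norm hip PP y.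
move: (rnorm_ge0 (P y)) (rnorm_ge0 (P' y)) P'y.
move: (rnorm (P y)) (rnorm (P' y)) (rnorm_ge0 y) => p q y0 p0 q0 qy e pq.
apply/rnorm0_eq0/eqP; rewrite eq_le rnorm_ge0 andbT leNgt; apply/negP => y1.
have p2 : p ^+ 2 <= tau ^+ 2 * q ^+ 2.
  by rewrite -exprMn ler_pXn2r ?nnegrE ?mulr_ge0.
have q2 : q ^+ 2 <= nu ^+ 2 * rnorm y ^+ 2.
  by rewrite -exprMn ler_pXn2r ?nnegrE ?mulr_ge0.
(* The angle condition divided by C; it makes (1 + tau^2) nu^2 < c^2 + nu^2 = 1. *)
have cS : tau * nu < c.
  by move: d0; rewrite SE subr_gt0 mulrAC (mulrC C) ltr_pM2r.
have c2 : tau ^+ 2 * nu ^+ 2 < c ^+ 2.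
  by rewrite -exprMn ltr_pXn2r ?nnegrE ?mulr_ge0// ltW.
have y2 : 0 < rnorm y ^+ 2 by rewrite exprn_gt0.
have : tau ^+ 2 * q ^+ 2 <= tau ^+ 2 * (nu ^+ 2 * rnorm y ^+ 2).
  by rewrite ler_wpM2l ?sqr_ge0.
have : tau ^+ 2 * nu ^+ 2 * rnorm y ^+ 2 < c ^+ 2 * rnorm y ^+ 2 by rewrite ltr_pM2r.
have : (c ^+ 2 + nu ^+ 2) * rnorm y ^+ 2 = rnorm y ^+ 2 by rewrite cn mul1r.
by move: p2 q2 e; lra.
Qed.

(** T (range Q) + range T' is dense, and T kills the second summand while fixing the first, so T
    (range Q) is dense in range T; it is also closed. *)
Lemma graph_image : T @` range Q = range T.
Proof.
apply/seteqP; split=> [_ [x _ <-]|z [z' _ z'z]]; first by exists x.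
have [cT _ idT _ hs] := TT; have [CT CT0 hT] := continuous_bounded cT.
have b1 : 0 < 1 + bound by rewrite ltr_pwDl// bound_ge0.
have cl : closed (T @` range Q).
  apply: (closed_image (c := (1 + bound)^-1) (C := CT)) => //.
  - by rewrite invr_gt0.
  - exact: pair_range_subspace.
  - exact: (pair_range_closed hip QQ).
  - move=> x /(pair_range QQ) Qx; rewrite ler_pdivrMl//; exact: graph_lower.
pose K : set V := [set u | exists2 x, Q x = x & exists l, u = T x + T' l].
have sK : subspace_set K.
  split; first by exists 0; [exact: linear0|exists 0; rewrite !linear0 addr0].
  move=> a _ _ [x Qx [l ->]] [x' Qx' [l' ->]].
  exists (a *: x + x'); first by rewrite linearP Qx Qx'.
  by exists (a *: l + l'); rewrite !linearP scalerDr addrACA.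
have /seteqP[_ /(_ z I)/closure_rnormP cz] : closure K = setT.
  apply: (closure_full hip) => // y hy; apply: graph_orthogonal.
    by move=> x Qx; apply: hy; exists x => //; exists 0; rewrite linear0 addr0.
  by move=> x; apply: hy; exists 0; [exact: linear0|exists x; rewrite linear0 add0r].
apply: cl; apply/closure_rnormP => e e0.
have [|_ [x Qx [l ->]] h] := cz (e / CT); first by rewrite divr_gt0.
exists (T x); first by exists x => //; apply/(pair_range QQ).
have -> : z - T x = T (z - (T x + T' l)).
  by rewrite linearB linearD !idT TT'0 addr0 -z'z idT.
by rewrite (le_lt_trans (hT _))// mulrC -ltr_pdivlMr.
Qed.

Lemma graph_inj : set_inj (range Q) T.
Proof.
move=> x y; rewrite !inE => /(pair_range QQ) Qx /(pair_range QQ) Qy e.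
apply/eqP; rewrite -subr_eq0; apply/eqP/rnorm0_eq0/eqP.
rewrite eq_le rnorm_ge0 andbT (le_trans (graph_lower _)) ?linearB ?Qx ?Qy//.
by rewrite e subrr rnorm0 mulr0.
Qed.

Local Notation g := ('pinv_(fun=> 0) (range Q) T).

Lemma graph_pinvK y : range T y -> T (g y) = y.
Proof. by move=> ry; apply: pinvK; rewrite inE graph_image. Qed.

Lemma graph_pinv_range y : range T y -> Q (g y) = g y.
Proof.
move=> ry; apply/(pair_range QQ).
have : (g @` (T @` range Q)) (g y) by exists y => //; rewrite graph_image.
by rewrite injpinv_image//; exact: graph_inj.
Qed.

Lemma graph_pinv x : Q x = x -> g (T x) = x.
Proof. by move=> Qx; apply: pinvKV; [exact: graph_inj|rewrite inE; exact/(pair_range QQ)]. Qed.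

Lemma graph_homeo : linear_homeo (range Q) (range T) T.
Proof.
split.
- split; [by move=> x _; exists x|exact: graph_inj|].
  by rewrite /set_surj graph_image.
- by have [cT _ _ _ _] := TT; exact: continuous_subspaceT.
apply/subspace_continuousP => y ry; apply/cvgrPdist_lt => e e0.
have eE : e = (complex.Re e)%:C by rewrite RRe_real// gtr0_real.
have re0 : 0 < complex.Re e by rewrite -ltr0c -eE.
have b1 : 0 < 1 + bound by rewrite ltr_pwDl// bound_ge0.
rewrite near_withinE; near=> z => rz.
rewrite rnormE eE ltcR (le_lt_trans (graph_lower _))//.
  by rewrite linearB !graph_pinv_range.
rewrite linearB !graph_pinvK// mulrC -ltr_pdivlMr//.
rewrite -ltcR -rnormE; near: z; apply: cvgr_dist_lt => //.
by rewrite ltr0c divr_gt0.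
Unshelve. all: by end_near. Qed.

Lemma graph_eq :
  range Q = [set x + angular_op T T' (range Q) x | x in range T].
Proof.
have [_ _ _ _ hs] := TT.
apply/seteqP; split => [x /(pair_range QQ) Qx|_ [y ry <-]].
  by exists (T x); [exists x|rewrite /angular_op graph_pinv].
apply/(pair_range QQ); rewrite /angular_op -{1 3}(graph_pinvK ry) hs.
exact: graph_pinv_range.
Qed.

Lemma graph_norm : (opnorm_on (range T) (angular_op T T' (range Q)) <= bound%:E)%E.
Proof.
apply: ub_ereal_sup => _ [x [rx x1] <-]; rewrite lee_fin -/(rnorm _) /angular_op.
rewrite (le_trans (graph_angle (graph_pinv_range rx)))// graph_pinvK//.
have x1' : rnorm x <= 1 by rewrite -lecR -rnormE.
by rewrite -[leRHS]mulr1 ler_wpM2l// bound_ge0.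
Qed.

End Graph.

(** * Block form of the perturbation *)

Section Block.
Context {R : realType} {V : completeNormedModType R[i]}.
Variable ip : {dot V for @Num.conj R[i]}.
Hypothesis hip : forall x : V, `|x| ^+ 2 = ip x x.
Variables (P P' M W : {linear V -> V}) (rho : R).
Hypothesis PP : orthogonal_pair ip P P'.
Hypothesis rho0 : 0 <= rho.
Hypothesis rho1 : rho < 1.
Hypothesis Msym : forall x y, ip (M x) y = ip x (M y).
Hypothesis Mrho : forall x y, (range P `|` range P') x -> (range P `|` range P') y ->
  rnorm (ip (M x) y) <= rho * rnorm x * rnorm y.
Hypothesis WE : forall x, W x = P x - P' x + M x.
Implicit Types x y : V.

Let J x := P x - P' x.

(** The numbers are the real parts of the diagonal and off-diagonal blocks of M at x. In the pairing
    with J x the off-diagonal ones cancel by symmetry of M. *)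
Let parts x : exists a b c : R,
  [/\ `|a| <= rho * rnorm (P x) ^+ 2, `|b| <= rho * rnorm (P' x) ^+ 2,
      `|c| <= rho * rnorm (P x) * rnorm (P' x),
      rip ip (W x) (J x) = rnorm x ^+ 2 + a - b &
      rip ip (W x) x = rnorm (P x) ^+ 2 - rnorm (P' x) ^+ 2 + a + b + 2 * c].
Proof.
have [hs sym _ _] := PP; have [_ sym' _ _] := orthogonal_pairC PP.
have o x' y' : rip ip (P x') (P' y') = 0 by rewrite /rip (pair_ip PP).
have Ms u w : rip ip (M u) w = rip ip (M w) u by rewrite /rip Msym ipC Re_cj.
have rP u : (range P `|` range P') (P u) by left; exists u.
have rP' u : (range P `|` range P') (P' u) by right; exists u.
exists (rip ip (M (P x)) (P x)), (rip ip (M (P' x)) (P' x)), (rip ip (M (P x)) (P' x)).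
split.
- by rewrite (le_trans (normRe_le _))// (le_trans (Mrho _ _))// expr2 mulrA.
- by rewrite (le_trans (normRe_le _))// (le_trans (Mrho _ _))// expr2 mulrA.
- by rewrite (le_trans (normRe_le _))// (le_trans (Mrho _ _)).
- rewrite (pair_norm hip PP x) WE -{3}(hs x) /J linearD -!(ripxx hip).
  rewrite !(ripDl, ripDr, ripNl, ripNr) o (ripC ip (P' x) (P x)) o.
  by rewrite (Ms (P' x) (P x)); ring.
- rewrite WE -{3 4}(hs x) linearD -!(ripxx hip).
  rewrite !(ripDl, ripDr, ripNl, ripNr) o (ripC ip (P' x) (P x)) o.
  by rewrite (Ms (P' x) (P x)); ring.
Qed.

Lemma block_coercive x : (1 - rho) * rnorm x ^+ 2 <= rip ip (W x) (J x).
Proof.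
have [a [b [c []]]] := parts x; rewrite !ler_norml => /andP[a1 a2] /andP[b1 b2] _ -> _.
by rewrite (pair_norm hip PP x); lra.
Qed.

Lemma block_form (s : R) x : s = 1 \/ s = -1 ->
  0 <= rip ip (W x) (J x - (s * (1 - rho))%:C *: x).
Proof.
have -> : rip ip (W x) (J x - (s * (1 - rho))%:C *: x) =
    rip ip (W x) (J x) - s * (1 - rho) * rip ip (W x) x by rewrite -ripZr -ripBr.
have [a [b [c []]]] := parts x.
move: (pair_norm hip PP x) (rnorm_ge0 (P x)) (rnorm_ge0 (P' x)).
move: (rnorm (P x)) (rnorm (P' x)) => p q -> p0 q0.
rewrite !ler_norml => /andP[a1 a2] /andP[b1 b2] /andP[c1 c2] -> ->.
have r1 : 0 <= 1 - rho by rewrite subr_ge0 ltW.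
have h1 : (1 - rho) * c <= (1 - rho) * (rho * p * q) by rewrite ler_wpM2l.
have h2 : (1 - rho) * (- (rho * p * q)) <= (1 - rho) * c by rewrite ler_wpM2l.
have h3 : rho * (- (rho * p ^+ 2)) <= rho * a by rewrite ler_wpM2l.
have h4 : rho * b <= rho * (rho * q ^+ 2) by rewrite ler_wpM2l.
have h5 : (1 - rho) * b <= (1 - rho) * (rho * q ^+ 2) by rewrite ler_wpM2l.
have h6 : (1 - rho) * (- (rho * p ^+ 2)) <= (1 - rho) * a by rewrite ler_wpM2l.
(* With k = 1 - rho, after the block bounds the expression is at least k rho (p - q)^2 + 2 k^2 q^2
   for s = 1, and the same with p^2 as last square for s = -1. *)
have h7 : 0 <= (1 - rho) * rho * (p - q) ^+ 2.
  exact: mulr_ge0 (mulr_ge0 r1 rho0) (sqr_ge0 _).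
have h8 : 0 <= (1 - rho) * (1 - rho) * q ^+ 2.
  exact: mulr_ge0 (mulr_ge0 r1 r1) (sqr_ge0 _).
have h9 : 0 <= (1 - rho) * (1 - rho) * p ^+ 2.
  exact: mulr_ge0 (mulr_ge0 r1 r1) (sqr_ge0 _).
by move=> [->|->]; lra.
Qed.

(* rho / (2 - rho) = (1 - k) / (1 + k) for k = 1 - rho. *)
Lemma block_angle (s : R) x : s = 1 \/ s = -1 ->
  0 <= s * rip ip (J x - (s * (1 - rho))%:C *: x) x ->
  if s == 1 then rnorm (P' x) <= Num.sqrt (rho / (2 - rho)) * rnorm (P x)
  else rnorm (P x) <= Num.sqrt (rho / (2 - rho)) * rnorm (P' x).
Proof.
set tau := Num.sqrt _ => hs h; have t0 : 0 <= tau by exact: sqrtr_ge0.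
have r2 : 0 < 2 - rho by have := rho1; lra.
have t2 : tau ^+ 2 = rho / (2 - rho) by rewrite sqr_sqrtr// divr_ge0// ltW.
have [hsum sym _ _] := PP; have [_ sym' _ _] := orthogonal_pairC PP.
have eJ : rip ip (J x) x = rnorm (P x) ^+ 2 - rnorm (P' x) ^+ 2.
  have o : rip ip (P x) (P' x) = 0 by rewrite /rip (pair_ip PP).
  rewrite /J -{3}(hsum x) ripBl !ripDr o (ripC ip (P' x) (P x)) o !(ripxx hip).
  by ring.
move: h; have -> : rip ip (J x - (s * (1 - rho))%:C *: x) x =
    rip ip (J x) x - s * (1 - rho) * rip ip x x by rewrite -ripZl -ripBl.
rewrite eJ (ripxx hip) (pair_norm hip PP x) => h.
have aux (p q : R) : 0 <= p -> 0 <= q -> (2 - rho) * q ^+ 2 <= rho * p ^+ 2 -> q <= tau * p.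
  move=> p0 q0 pq; rewrite -(ler_pXn2r (n := 2)) ?nnegrE ?mulr_ge0//.
  by rewrite exprMn t2 mulrAC ler_pdivlMr// mulrC.
case: hs h => -> h; first by rewrite eqxx; apply: aux; rewrite ?rnorm_ge0//; lra.
rewrite ifF; first by apply: aux; rewrite ?rnorm_ge0//; lra.
by apply/negbTE/eqP; lra.
Qed.

(** J is isometric, so coercivity against J x bounds W below; W is symmetric, so a vector orthogonal
    to its range is in its kernel. *)
Lemma block_inverse (CM : R) : (forall x, rnorm (M x) <= CM * rnorm x) ->
  exists Wi : {linear V -> V}, [/\ forall x, W (Wi x) = x, forall x, Wi (W x) = x
    & forall x, rnorm (Wi x) <= (1 - rho)^-1 * rnorm x].
Proof.
move=> bM; have r1 : 0 < 1 - rho by rewrite subr_gt0.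
have [hs sym _ _] := PP.
have Jn x : rnorm (J x) = rnorm x.
  apply/eqP; rewrite -(eqrXn2 (n := 2)) ?rnorm_ge0//; apply/eqP.
  by rewrite (rnormB2 hip) /rip (pair_ip PP) mulr0 subr0 -(pair_norm hip PP).
have low x : (1 - rho) * rnorm x <= rnorm (W x).
  have [->|n0] := eqVneq (rnorm x) 0; first by rewrite mulr0 rnorm_ge0.
  have p : 0 < rnorm x by rewrite lt_def n0 rnorm_ge0.
  rewrite -(ler_pM2r p) -mulrA -expr2; apply: le_trans (block_coercive x) _.
  by have := rip_le hip (W x) (J x); rewrite Jn.
apply: (symmetric_bijective hip r1 low).
- move=> y hy; apply/rnorm0_eq0/eqP; rewrite eq_le rnorm_ge0 andbT.
  have [_ sym' _ _] := orthogonal_pairC PP.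
  have Wy : W y = 0.
    apply: (ip_ext hip) => x; rewrite ip0l -(hy x) !WE.
    by rewrite !(ipDl, ipDr, ipNl, ipNr) Msym sym sym'.
  by rewrite -(ler_pM2l r1) mulr0; have := low y; rewrite Wy rnorm0.
- have -> : range W = W @` setT by [].
  apply: (closed_image (c := 1 - rho) (C := 1 + CM)) => //.
  by move=> x; rewrite WE (le_trans (rnormD _ _))// mulrDl mul1r lerD// [leLHS]Jn.
Qed.

End Block.

(** * Transfer of the hypotheses to operators, and the theorem *)

Section Assembly.
Context {R : realType} {V : completeNormedModType R[i]}.
Variable ip : {dot V for @Num.conj R[i]}.
Hypothesis hip : forall x : V, `|x| ^+ 2 = ip x x.
Implicit Types x y z : V.

Lemma dense_eq0 (K : set V) (f : V -> R[i]) (C : R) :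
  (forall x y, f (x - y) = f x - f y) -> (forall x, rnorm (f x) <= C * rnorm x) ->
  (forall x, K x -> f x = 0) -> forall x, closure K x -> f x = 0.
Proof.
move=> fB fC fK x /closure_rnormP cx; apply/rnorm0_eq0/eqP.
rewrite eq_le rnorm_ge0 andbT leNgt; apply/negP => p.
have C1 : 0 < `|C| + 1 by rewrite ltr_wpDl.
have [|k Kk xk] := cx (rnorm (f x) / (`|C| + 1)); first by rewrite divr_gt0.
have := fC (x - k); rewrite fB (fK _ Kk) subr0.
move: xk; rewrite ltr_pdivlMr//.
have := ler_wpM2r (rnorm_ge0 (x - k)) (ler_norm C); have := rnorm_ge0 (x - k).
by lra.
Qed.

Lemma opnorm_bound (f : {linear V -> V}) (nu : R) :
  opnorm_on setT f = nu%:E -> 0 <= nu /\ forall x, rnorm (f x) <= nu * rnorm x.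
Proof.
move=> h; have ub x : rnorm x <= 1 -> rnorm (f x) <= nu.
  move=> x1; rewrite -lee_fin -h; apply: ereal_sup_ubound; exists x => //.
  by split => //; rewrite rnormE lecR.
split.
  by apply: le_trans (ub 0 _); rewrite ?linear0 rnorm0.
move=> x; have [x0|n0] := eqVneq (rnorm x) 0.
  by rewrite (rnorm0_eq0 x0) linear0 rnorm0 mulr0.
have p : 0 < rnorm x by rewrite lt_def n0 rnorm_ge0.
have := ub ((rnorm x)^-1%:C *: x).
rewrite linearZ !rnormZ rnormC ger0_norm ?invr_ge0 ?rnorm_ge0// mulVf//.
by move=> /(_ (lexx _)); rewrite mulrC ler_pdivrMr.
Qed.

Lemma spectral_pair (E : pvm ip) (e : R) : 0 < e ->
  (forall y, E `[- e, e]%classic y = 0) ->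
  orthogonal_pair ip (pos_proj E) (neg_proj E).
Proof.
move=> e0 h; split.
- by move=> x; exact: (pos_neg_proj hip x e0 h).
- by move=> x y; rewrite !pos_projE; exact: (pvm_sym E x y mpos).
- by move=> x; rewrite !pos_projE; exact: (pvm_idem E x mpos).
- move=> x; rewrite pos_projE neg_projE (pvm_projI E mpos mneg).
  rewrite (_ : posR `&` negR = set0) ?(pvm_proj0 hip)//.
  by apply/seteqP; split => t //; rewrite /posR /negR/= !in_itv/= andbT => -[]; lra.
Qed.

Lemma complementaryC (P P' : {linear V -> V}) :
  complementary_projections P P' -> complementary_projections P' P.
Proof. by move=> [c c' i i' h]; split => // x; rewrite addrC. Qed.

Lemma pos_set1 : [set t : measurableTypeR R | 0 < 1 * (t : R)] = posR.
Proof.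
by apply/seteqP; split => t; rewrite /posR/= mul1r in_itv/= andbT.
Qed.

Lemma neg_set1 : [set t : measurableTypeR R | 0 < -1 * (t : R)] = negR.
Proof.
by apply/seteqP; split => t; rewrite /negR/= mulN1r oppr_gt0 in_itv.
Qed.

(** Symmetry is given only on the core. Graph-norm approximation of (B x, x) shows that the k with B
    k in [D] are dense, and the identity extends from them one variable at a time. *)
Lemma form_matrix (S : set (V * V)) (B : {linear V -> V}) (D : set V)
    (v0 v : V -> V -> R[i]) :
  (forall x, B x = 0 -> x = 0) -> (forall x y, S (x, y) <-> x = B y) ->
  symmetric_on D v0 -> op_core D S -> form_extension S D v0 v ->
  exists2 M : {linear V -> V}, forall x y, ip (M x) y = v (B x) (B y) &
    (forall x y, ip (M x) y = ip x (M y)) /\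
    exists2 C : R, 0 <= C & forall x, rnorm (M x) <= C * rnorm x.
Proof.
move=> Binj SB v0sym [sD DS clD] [vv0 [sS vl vr] [C vC]].
have dB x : op_dom S (B x) by exists x; apply/SB.
have aB x := op_app_graph Binj SB x.
pose C' := `|C|; have C0 : 0 <= C' by exact: normr_ge0.
have bnd x y : rnorm (v (B x) (B y)) <= C' * rnorm x * rnorm y.
  have := vC _ _ (dB x) (dB y); rewrite !aB !rnormE -!rmorphM lecR => h.
  apply: le_trans h _; rewrite !ler_wpM2r ?rnorm_ge0 ?ler_norm//.
have ses : sesquilinear_on setT (fun x y => v (B x) (B y)).
  split; first by [].
    by move=> a u u' w _ _ _; rewrite linearP vl.
  by move=> a u w w' _ _ _; rewrite linearP vr.
have [M hM] := form_operator hip ses bnd.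
have Mbnd x : rnorm (M x) <= C' * rnorm x.
  by apply: (form_operator_le hip) => // x' y; rewrite hM.
pose K : set V := [set k | D (B k)].
have Kdense x : closure K x.
  have : S (B x, x) by apply/SB.
  rewrite -clD => cS; apply/closure_rnormP => e e0.
  have [|[u w] [[/SB uw /= Du]]] := cS (ball (B x, x) e%:C).
    by apply: nbhsx_ballx; rewrite ltr0c.
  move=> -[/= _]; rewrite -ball_normE/= rnormE ltcR => xw.
  by exists w => //; rewrite /K/= -uw.
have KK k l : K k -> K l -> ip (M k) l = ip k (M l).
  move=> Kk Kl; rewrite [RHS]ipC !hM !vv0//.
  exact: v0sym.
exists M => //; split; last by exists C'.
have Kl x l : K l -> ip (M x) l = ip x (M l).
  move=> hl; apply/eqP; rewrite -subr_eq0; apply/eqP.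
  apply: (@dense_eq0 K (fun x => ip (M x) l - ip x (M l)) (C' * rnorm l + rnorm (M l))).
  - by move=> x' y'; rewrite linearB !ipBl; ring.
  - move=> x'; apply: le_trans (rnormD _ _) _; rewrite rnormN.
    have := ip_le hip (M x') l; have := ip_le hip x' (M l).
    by have := ler_wpM2r (rnorm_ge0 l) (Mbnd x'); lra.
  - by move=> k Kk; rewrite KK// subrr.
  - exact: Kdense.
move=> x y; apply/eqP; rewrite -subr_eq0; apply/eqP.
apply: (@dense_eq0 K (fun y => ip (M x) y - ip x (M y)) (rnorm (M x) + C' * rnorm x)).
- by move=> x' y'; rewrite (linearB M) !ipBr; ring.
- move=> x'; apply: le_trans (rnormD _ _) _; rewrite rnormN.
  have := ip_le hip (M x) x'; have := ip_le hip x (M x').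
  by have := ler_wpM2l (rnorm_ge0 x) (Mbnd x'); lra.
- by move=> k Kk; rewrite Kl// subrr.
- exact: Kdense.
Qed.

(** Expand (x + X x, y + Y y) = 0: orthogonality of the ranges of T and T' removes (x, y) and (X x,
    Y y). *)
Lemma angular_adjoint (T T' Q Q' : {linear V -> V}) :
  complementary_projections T T' -> orthogonal_pair ip Q Q' ->
  range Q = [set x + angular_op T T' (range Q) x | x in range T] ->
  range Q' = [set y + angular_op T' T (range Q') y | y in range T'] ->
  (forall x y, ip (T x) (T' y) = 0) ->
  adjoint_on ip (range T) (range T') (angular_op T T' (range Q))
    (fun y => - angular_op T' T (range Q') y).
Proof.
move=> _ QQ eQ eQ' o; split.
- by move=> x _; rewrite /angular_op; exists ('pinv_(fun=> 0) (range Q) T x).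
- move=> y _; exists (- 'pinv_(fun=> 0) (range Q') T' y) => //.
  by rewrite linearN.
move=> x y rx ry; set X := angular_op T T' (range Q) x.
set Y := angular_op T' T (range Q') y.
have o' u w : ip (T' u) (T w) = 0 by rewrite ipC o rmorph0.
have q : range Q (x + X) by rewrite eQ; exists x.
have q' : range Q' (y + Y) by rewrite eQ'; exists y.
have : ip (x + X) (y + Y) = 0.
  by case: q q' => a _ <- [b _ <-]; exact: (pair_ip QQ).
have XY : ip X Y = 0 by rewrite /X /Y /angular_op o'.
have xy : ip x y = 0 by case: rx ry => a _ <- [b _ <-].
rewrite ipDl !ipDr XY xy addr0 add0r ipNr addrC => /eqP.
by rewrite addr_eq0 => /eqP.
Qed.

End Assembly.

Theorem theorem3p3 (R : realType) (V : completeNormedModType R[i])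
  (ip : {dot V for @Num.conj R[i]})
  (hip : forall x : V, `|x| ^+ 2 = ip x x)
  (H0 : set (V * V)) (delta : R)
  (hH0 : self_adjoint ip H0)
  (hdelta : 0 < delta)
  (hgap : forall t : R, - delta < t < delta -> resolvent_set H0 t%:C)
  (E0 : pvm ip) (hE0 : spectral_measure_of E0 H0)
  (D : set V) (v0 v : V -> V -> R[i])
  (hv0 : sesquilinear_on D v0) (hv0sym : symmetric_on D v0)
  (hcore : op_core D (sqrt_abs E0))
  (hv : form_extension (sqrt_abs E0) D v0 v)
  (hbounded : has_ubound (form_values E0 v setT))
  (rho : R)
  (hrho : rho = sup (form_values E0 v
                       (range (pos_proj E0) `|` range (neg_proj E0))))
  (hrho1 : rho < 1)
  (Pp Pm : {linear V -> V}) (hP : complementary_projections Pp Pm)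
  (nu : R)
  (hnup : opnorm_on setT (fun x => pos_proj E0 x - Pp x) = nu%:E)
  (hnum : opnorm_on setT (fun x => neg_proj E0 x - Pm x) = nu%:E)
  (hnu1 : nu < 1)
  (hangle : atan (Num.sqrt (rho / (2 - rho))) + asin nu < pi / 2) :
  exists H : set (V * V),
    [/\ unique (fun H' : set (V * V) =>
                  self_adjoint ip H' /\
                  associated ip H' (op_dom (sqrt_abs E0))
                    (fun u w => h0_form E0 u w + v u w)) H,
        resolvent_set H 0,
        op_core (op_dom H) (sqrt_abs E0)
      & forall F : pvm ip, spectral_measure_of F H ->
        let QpV := range (pos_proj F) in
        let QmV := range (neg_proj F) in
        let Xp := angular_op Pp Pm QpV in
        let Xm := angular_op Pm Pp QmV in
        let bound : R := tan (atan (Num.sqrt (rho / (2 - rho))) + asin nu) in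
        [/\ linear_homeo QpV (range Pp) Pp /\ linear_homeo QmV (range Pm) Pm,
            QpV = [set x + Xp x | x in range Pp] /\
            QmV = [set y + Xm y | y in range Pm],
            (opnorm_on (range Pp) Xp <= bound%:E)%E /\
            (opnorm_on (range Pm) Xm <= bound%:E)%E
          & (forall x y : V, ip (Pp x) (Pm y) = 0) ->
            adjoint_on ip (range Pp) (range Pm) Xp (fun y => - Xm y)]].
Proof.
have hgap0 : resolvent_set H0 0.
  by have := hgap 0; rewrite oppr_lt0 hdelta /=; apply.
have [e e0 he] := pvm_gap hip hE0 hgap0.
set P := pos_proj E0; set P' := neg_proj E0.
have PP : orthogonal_pair ip P P' := spectral_pair hip e0 he.
have [B [Bsym [CB CB0 Bbnd] Bcomm Binj SB]] := sqrt_abs_inverse hip e0 he.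
have [M hM [Msym [CM CM0 Mbnd]]] := form_matrix hip Binj SB hv0sym hcore hv.
have iB x : op_app (op_inv (sqrt_abs E0)) x = B x by exact: op_app_inv_graph SB x.
pose Wset := range P `|` range P'.
have ub : has_ubound (form_values E0 v Wset).
  have [b hb] := hbounded; exists b => _ [x [y [_ _ x1 y1 ->]]].
  by apply: hb; exists x, y.
have fv x y : Wset x -> Wset y -> rnorm x = 1 -> rnorm y = 1 ->
    form_values E0 v Wset (rnorm (ip (M x) y)).
  by move=> Wx Wy x1 y1; exists x, y; split; rewrite ?rnormE ?x1 ?y1 ?iB ?hM.
have rho0 : 0 <= rho.
  (* Without unit vectors the set of values is empty, and its [sup] is 0 by convention. *)
  rewrite hrho; have [->|/set0P[r [x [y [Wx Wy x1 y1 rE]]]]] :=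
    eqVneq (form_values E0 v Wset) set0; first by rewrite sup0.
  apply: le_trans (ub_le_sup ub (ex_intro _ x (ex_intro _ y (And5 Wx Wy x1 y1 rE)))).
  by rewrite rE; exact: (rnorm_ge0 (v _ _)).
have WZ (t : R[i]) x : Wset x -> Wset (t *: x).
  by move=> [[u _ <-]|[u _ <-]]; [left|right]; exists (t *: u) => //; rewrite linearZ.
have Mrho x y : Wset x -> Wset y -> rnorm (ip (M x) y) <= rho * rnorm x * rnorm y.
  move=> Wx Wy.
  have [x0|nx0] := eqVneq (rnorm x) 0.
    by rewrite x0 (rnorm0_eq0 x0) linear0 ip0l rnorm0 mulr0 mul0r.
  have [y0|ny0] := eqVneq (rnorm y) 0.
    by rewrite y0 (rnorm0_eq0 y0) ip0r rnorm0 mulr0.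
  have nrm (z : V) : rnorm z != 0 -> rnorm ((rnorm z)^-1%:C *: z) = 1.
    by move=> nz; rewrite rnormZ rnormC ger0_norm ?invr_ge0 ?rnorm_ge0// mulVf.
  have := ub_le_sup ub (fv _ _ (WZ (rnorm x)^-1%:C _ Wx) (WZ (rnorm y)^-1%:C _ Wy)
    (nrm _ nx0) (nrm _ ny0)).
  rewrite -hrho (linearZ_LR M)/= ipZl ipZr conjC_real !rnormM !rnormC.
  rewrite !ger0_norm ?invr_ge0 ?rnorm_ge0// mulrA -invfM mulrC ler_pdivrMr ?mulrA//.
  by rewrite mulr_gt0// lt_def ?nx0 ?ny0 rnorm_ge0.
pose W : {linear V -> V} := (P \- P') \+ M.
have WE x : W x = P x - P' x + M x by [].
have [_ symP _ _] := PP; have [_ symP' _ _] := orthogonal_pairC PP.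
have Wsym x y : ip (W x) y = ip x (W y).
  by rewrite !WE !(ipDl, ipDr, ipNl, ipNr) symP symP' Msym.
have [Wi [WK WiK Wibnd]] := block_inverse hip PP hrho1 Msym Mrho WE Mbnd.
have CW0 : 0 < (1 - rho)^-1 by rewrite invr_gt0 subr_gt0.
pose h := fun u w => h0_form E0 u w + v u w.
have hE x y : h (B x) (B y) = ip (W x) y.
  rewrite /h /h0_form !(op_app_graph Binj SB) (sign_opE hip) -hM WE.
  by rewrite !(ipDl, ipDr, ipNl, ipNr) symP symP'.
pose H := form_op B Wi; exists H.
have Hsa : self_adjoint ip H by exact: (form_op_self_adjoint hip (W := W)).
have Hres : resolvent_set H 0 by exact: (form_op_resolvent CB0 CW0).
split.
- split; first by split=> //; exact: (form_op_associated hip CB0 CW0 (W := W)).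
  by move=> H' [sa as']; exact: (form_op_unique hip (W := W) (h := h)).
- exact: Hres.
- exact: (form_op_core hip CB0 (W := W)).
move=> F hF QpV QmV Xp Xm bound.
have [e' e'0 he'] := pvm_gap hip hF Hres.
pose Q := pos_proj F; pose Q' := neg_proj F.
have QQ : orthogonal_pair ip Q Q' := spectral_pair hip e'0 he'.
pose tau := Num.sqrt (rho / (2 - rho)).
have tau0 : 0 <= tau by exact: sqrtr_ge0.
(* Both half-lines at once: the Lyapunov form is s (J - s (1 - rho)), that is J - k for s = 1 and
   -(J + k) for s = -1, where k = 1 - rho. *)
have lyap (s : R) x : s = 1 \/ s = -1 ->
    F [set t : measurableTypeR R | 0 < s * (t : R)] x = x ->
    0 <= s * rip ip (P x - P' x - (s * (1 - rho))%:C *: x) x.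
  move=> hs Fx; set k : R[i] := (s * (1 - rho))%:C.
  have ss : s * s = 1 by case: hs => ->; ring.
  pose G : {linear V -> V} := s%:C \*: ((P \- P') \- (k \*: idfun)).
  have GE y : G y = s%:C *: (P y - P' y - k *: y) by [].
  have symG y z : rip ip (G y) z = rip ip y (G z).
    rewrite !GE ripZl ripZr; congr (_ * _).
    by rewrite !(ripDl, ripDr, ripNl, ripNr) ripZl ripZr /rip symP symP'.
  have bndG y : rnorm (G y) <= 4 * rnorm y.
    rewrite GE rnormZ rnormC (_ : `|s| = 1); last first.
      by case: hs => ->; rewrite ?normrN normr1.
    have k1 : rnorm (k *: y) <= rnorm y.
      rewrite rnormZ rnormC normrM (_ : `|s| = 1); last first.
        by case: hs => ->; rewrite ?normrN normr1.
      rewrite mul1r ger0_norm; last by rewrite subr_ge0 ltW.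
      by rewrite ler_piMl ?rnorm_ge0// gerBl.
    have := rnormD (P y - P' y) (- (k *: y)); have := rnormD (P y) (- P' y).
    rewrite !rnormN; have := pair_le hip PP y; have := pair_le hip (orthogonal_pairC PP) y.
    by have := rnorm_ge0 y; lra.
  rewrite -ripZl -GE; apply: (lyapunov hip symG bndG ss _ Fx) => u w.
  rewrite (hF : pvm_fun F idfun = H) => Huw.
  have -> : u = form_inv B Wi w by exact: Huw.
  rewrite GE ripZr mulrA ss mul1r.
  set z := Wi (B w).
  (* For u = B z and z = W^-1 B w, B commutes with P and P' and moves across the inner product, so
     Re (H u, (J - s k) u) becomes Re (W z, (J - s k) z), the block estimate. *)
  have -> : P (form_inv B Wi w) - P' (form_inv B Wi w) - k *: form_inv B Wi w =
      B (P z - P' z - k *: z).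
    have [c1 c2] : B (P z) = P (B z) /\ B (P' z) = P' (B z) := Bcomm z.
    by rewrite /form_inv -/z !(linearB B) (linearZ_LR B)/= c1 c2.
  rewrite /rip -Bsym -(WK (B w)) -/z -/(rip _ _ _).
  exact: (block_form hip PP rho0 hrho1 Msym Mrho WE z hs).
have angQ x : Q x = x -> rnorm (P' x) <= tau * rnorm (P x).
  move=> Qx; have := lyap 1 x (or_introl erefl); rewrite pos_set1 => /(_ Qx).
  move/(block_angle hip PP rho0 hrho1 (or_introl erefl)); by rewrite eqxx.
have angQ' x : Q' x = x -> rnorm (P x) <= tau * rnorm (P' x).
  move=> Qx; have := lyap (-1) x (or_intror erefl); rewrite neg_set1 => /(_ Qx).
  move/(block_angle hip PP rho0 hrho1 (or_intror erefl)); rewrite ifF//.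
  by apply/negbTE/eqP; lra.
have [nu0 PT] := @opnorm_bound R V (P \- Pp) nu hnup.
have [_ PT'] := @opnorm_bound R V (P' \- Pm) nu hnum.
(* The statements for the negative part are those for the positive one with the two members of each
   pair exchanged. *)
have hP' := complementaryC hP.
have PP' := orthogonal_pairC PP; have QQ' := orthogonal_pairC QQ.
have eqp := graph_eq hip PP QQ hP tau0 nu0 hnu1 hangle PT PT' angQ angQ'.
have eqm := graph_eq hip PP' QQ' hP' tau0 nu0 hnu1 hangle PT' PT angQ' angQ.
split.
- split; first exact: (graph_homeo hip PP QQ hP tau0 nu0 hnu1 hangle PT PT' angQ angQ').
  exact: (graph_homeo hip PP' QQ' hP' tau0 nu0 hnu1 hangle PT' PT angQ' angQ).
- by split; [exact: eqp|exact: eqm].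
- split; first exact: (graph_norm hip PP QQ hP tau0 nu0 hnu1 hangle PT PT' angQ angQ').
  exact: (graph_norm hip PP' QQ' hP' tau0 nu0 hnu1 hangle PT' PT angQ' angQ).
- exact: (angular_adjoint hP QQ eqp eqm).
Qed.
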